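(* Fix integers $q\ge 3$, $m\ge 1$, and reals $\lambda\in(0,1)$, $J>0$. Consider the Glauber dynamics of the homogeneous $m$-component Curie-Weiss-Potts model with $q$ spins, component size $N$, and inverse temperature $\beta>0$, and let $t_{\mathrm{MIX}}=t_{\mathrm{MIX}}(N)$ be its mixing time. If $0<\beta<\beta_s(q)/J$, then for all sufficiently large $N$, $$t_{\mathrm{MIX}}=O(N\log N),$$ i.e. there are a constant $C>0$ (independent of $N$) and $N_0$ such that $t_{\mathrm{MIX}}(N)\le C\,N\log N$ for all $N\ge N_0$.
   Context: Model. The parameters $q,m,\lambda,J,\beta$ are fixed and do not depend on $N$. The vertex set $V$ has $Nm$ elements and is partitioned into $m$ components $V_1,\dots,V_m$, each of size $N$. Configurations are the elements $\sigma$ of $\Sigma=\{1,\dots,q\}^V$. For $v,w\in V$ set $\mathcal J(v,w)=\frac{J}{1+(m-1)\lambda}$ if $v,w$ lie in the same component and $\mathcal J(v,w)=\frac{J\lambda}{1+(m-1)\lambda}$ if they lie in different components. The Gibbs measure is $$\mu_{N,\beta}(\sigma)=\frac1{Z_{N,\beta}}\exp\Big(\frac{\beta}{N}\sum_{v,w\in V}\mathcal J(v,w)\mathbf 1\{\sigma(v)=\sigma(w)\}\Big),$$ where the sum is over all ordered pairs $(v,w)$ and $Z_{N,\beta}$ is the normalizing constant. Glauber dynamics. The discrete-time Markov chain $(\sigma_t)_{t\ge0}$ on $\Sigma$ that at each step picks a vertex $v\in V$ uniformly at random and resamples the spin at $v$ from $\mu_{N,\beta}$ conditioned on the spins at all vertices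 $w\neq v$ being unchanged. $\mathbb P_\sigma$ is the law of the chain started from $\sigma$. Mixing time. $t_{\mathrm{MIX}}=\inf\{t>0:\max_{\sigma\in\Sigma}\|\mathbb P_\sigma[\sigma_t\in\cdot]-\mu_{N,\beta}\|_{\mathrm{TV}}\le 1/4\}$. Threshold. $\beta_s(q)=\sup\Big\{\beta>0:\big(1+(q-1)e^{2\beta\frac{1-qx}{q-1}}\big)^{-1}-x\neq0\ \text{for all }x\in(1/q,1)\Big\}$. *)

(* Defs.v *)
From HB Require Import structures.
From mathcomp Require Import all_boot all_order all_algebra.
From mathcomp Require Import all_classical all_reals all_analysis.
From mathcomp Require Import ring lra.

Set Implicit Arguments.
Unset Strict Implicit.
Unset Printing Implicit Defensive.

Import Order.TTheory GRing.Theory Num.Theory.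
Import numFieldNormedType.Exports.

Local Open Scope classical_set_scope.
Local Open Scope ring_scope.

(** The vertex (i, k) is the k-th vertex of the component V_i. *)
Notation vertex m N := ('I_m * 'I_N)%type.

Notation config q m N := {ffun vertex m N -> 'I_q}.

Definition interaction (R : realType) (m N : nat) (lam J : R)
    (v w : vertex m N) : R :=
  if v.1 == w.1 then J / (1 + (m%:R - 1) * lam)
  else J * lam / (1 + (m%:R - 1) * lam).

(** The sum runs over ordered pairs, including the diagonal v = w. *)
Definition gibbs_weight (R : realType) (q m N : nat) (lam J beta : R)
    (s : config q m N) : R :=
  expR (beta / N%:R *
        \sum_(v : vertex m N) \sum_(w : vertex m N)
          interaction lam J v w * (s v == s w)%:R).

Definition partition_function (R : realType) (q m N : nat)
    (lam J beta : R) : R :=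
  \sum_(s : config q m N) gibbs_weight lam J beta s.

Definition gibbs (R : realType) (q m N : nat) (lam J beta : R)
    (s : config q m N) : R :=
  gibbs_weight lam J beta s / partition_function q m N lam J beta.

Definition agree_off (q m N : nat) (v : vertex m N)
    (s t : config q m N) : bool :=
  [forall w, (w != v) ==> (t w == s w)].

(** Law obtained from s by resampling the spin at v: the Gibbs measure
    conditioned on the configurations that coincide with s away from v. *)
Definition resample (R : realType) (q m N : nat) (lam J beta : R)
    (v : vertex m N) (s t : config q m N) : R :=
  if agree_off v s t then
    gibbs lam J beta t / \sum_(u | agree_off v s u) gibbs lam J beta u
  else 0.

Definition glauber (R : realType) (q m N : nat) (lam J beta : R)
    (s t : config q m N) : R :=
  #|{: vertex m N}|%:R^-1 * \sum_(v : vertex m N) resample lam J beta v s t.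

(** [glauber_law lam J beta s n t] is P_s[sigma_n = t]. *)
Fixpoint glauber_law (R : realType) (q m N : nat) (lam J beta : R)
    (s : config q m N) (n : nat) (t : config q m N) : R :=
  if n is n'.+1 then
    \sum_(u : config q m N)
      glauber_law lam J beta s n' u * glauber lam J beta u t
  else (s == t)%:R.

Definition total_variation (R : realType) (T : finType) (P Q : T -> R) : R :=
  \big[Num.max/0]_(A : {set T}) `|\sum_(x in A) P x - \sum_(x in A) Q x|.

(** Valued in the extended reals, so that the infimum of the empty set
    is +oo. *)
Definition tmix (R : realType) (q m N : nat) (lam J beta : R) : \bar R :=
  ereal_inf [set (n%:R)%:E | n in [set n : nat | (0 < n)%N /\
    \big[Num.max/0]_(s : config q m N)
      total_variation (glauber_law lam J beta s n) (gibbs lam J beta)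
      <= 4^-1]].

Definition beta_s_set (R : realType) (q : nat) : set R :=
  [set b | 0 < b /\ forall x : R, q%:R^-1 < x -> x < 1 ->
    (1 + (q%:R - 1) * expR (2 * b * ((1 - q%:R * x) / (q%:R - 1))))^-1 - x
      != 0].
Arguments beta_s_set : clear implicits.

Definition beta_s (R : realType) (q : nat) : R := sup (beta_s_set R q).
Arguments beta_s : clear implicits.

(** [sup] defaults to 0 on sets without a supremum; this is not the case
    here. *)
Lemma beta_s_has_sup (R : realType) (q : nat) :
  (3 <= q)%N -> has_sup (beta_s_set R q).
Proof.
move=> q3.
have Q3 : (3 : R) <= q%:R by rewrite ler_nat.
have Q1 : 0 < q%:R - 1 :> R by lra.
split.
  exists 2^-1; split => [|x x0 x1]; first by lra.
  have xq : 1 < q%:R * x.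
    by rewrite -(@ltr_pM2l _ q%:R) ?divff ?lt0r_neq0 // in x0; lra.
  rewrite (_ : 2 * 2^-1 * _ = (1 - q%:R * x) / (q%:R - 1)); last by lra.
  set e := expR _.
  have eD : q%:R + 1 - q%:R * x <= 1 + (q%:R - 1) * e.
    have := @expR_ge1Dx R ((1 - q%:R * x) / (q%:R - 1)).
    rewrite -/e -(ler_pM2l Q1) mulrDr mulr1 mulrCA divff ?lt0r_neq0 //; lra.
  have e0 : 0 < e by exact: expR_gt0.
  have D0 : 0 < 1 + (q%:R - 1) * e by rewrite addr_gt0 // mulr_gt0.
  apply/negP => /eqP /eqP; rewrite subr_eq0 => /eqP E.
  have x00 : 0 < x by rewrite -E invr_gt0.
  have : x * (1 + (q%:R - 1) * e) = 1 by rewrite -E mulVf ?lt0r_neq0.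
  have : x * (q%:R + 1 - q%:R * x) <= x * (1 + (q%:R - 1) * e).
    by rewrite ler_pM2l.
  nra.
exists ((q%:R - 1) * (q%:R - 1) / (q%:R - 2)) => b [b0 nz].
rewrite leNgt; apply/negP => bq.
pose f (x : R) :=
  (1 + (q%:R - 1) * expR (2 * b * ((1 - q%:R * x) / (q%:R - 1))))^-1 - x.
have D0 x : 0 < 1 + (q%:R - 1) * expR (2 * b * ((1 - q%:R * x) / (q%:R - 1))).
  by rewrite addr_gt0 // mulr_gt0 // expR_gt0.
have f1 : f 1 < 0.
  rewrite /f subr_lt0 invf_lt1 // ltrDl mulr_gt0 ?expR_gt0 //.
have f2 : 0 <= f 2^-1.
  rewrite /f subr_ge0 lef_pV2 ?posrE //.
  rewrite -lerBrDl (_ : 2 - 1 = 1); last by lra.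
  set c := (2 * b * _).
  have Ec : c = - (b * (q%:R - 2) / (q%:R - 1)).
    by rewrite /c; field; apply: lt0r_neq0.
  rewrite Ec expRN ler_pdivrMr ?expR_gt0 // mul1r.
  have : q%:R - 1 < b * (q%:R - 2) / (q%:R - 1).
    rewrite ltr_pdivlMr //; rewrite ltr_pdivrMr in bq; lra.
  have := @expR_ge1Dx R (b * (q%:R - 2) / (q%:R - 1)); lra.
have fc : continuous f.
  move=> x; apply: cvgB; last exact: cvg_id.
  apply: cvgV; first exact: lt0r_neq0.
  apply: cvgD; first exact: cvg_cst.
  apply: cvgMl_tmp.
  apply: continuous_comp; last exact: continuous_expR.
  apply: cvgMl_tmp; apply: cvgMr_tmp; apply: cvgB; first exact: cvg_cst.
  by apply: cvgMl_tmp; exact: cvg_id.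
have [|||c] := @IVT R f 2^-1 1 0.
- by lra.
- exact: continuous_subspaceT.
- by rewrite ge_min le_max f2 (ltW f1) orbT.
rewrite in_itv /= => /andP[c2 c1] fc0.
have c1' : c < 1.
  by rewrite lt_neqAle c1 andbT; apply/eqP => E; move: f1; rewrite -E fc0 ltxx.
have qc : q%:R^-1 < c by apply: lt_le_trans c2; rewrite ltf_pV2 ?posrE; lra.
by have := nz c qc c1'; rewrite -/(f c) fc0 eqxx.
Qed.

(* Main.v *)
(** Two copies of the chain are run together: the same vertex is picked in both
    and the two new spins are drawn from a maximal coupling of the heat-bath
    laws, which are softmax functions of the local fields.

    Let [b = beta * J] and let [h] be the map [x |-> potts_map b x] of the
    definition of [beta_s]. If all colour proportions in all components are at
    most [M], then by Jensen every heat-bath probability is at most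
    [h M + O(1/N)]. Below the threshold [h M <= M - kappa] for
    [M >= 1/q + eps], so the largest proportions drift down. For a small
    constant [theta] the sum [Phi] of [exp (theta * colour count)] over all
    components and colours therefore contracts by a constant factor in each
    step while [M >= 1/q + eps]. After [O(N)] steps from any start, all
    proportions are below [1/q + 2 eps] except on an event of exponentially
    small probability.

    When both copies are in that region, the fields at a vertex have equal
    total mass and are nearly constant in the colour, and there the softmax is
    l1-Lipschitz with a constant close to [1/q]. The expected Hamming distance
    then contracts by [1 - c/N] per step, because [2 b / q < 1] is forced by
    [b < beta_s]. Hence [O(N log N)] further steps suffice. *)

Require Import Defs.
From mathcomp Require Import all_boot all_order all_algebra.
From mathcomp Require Import all_classical all_reals all_analysis.
From mathcomp Require Import ring lra.

Import Order.TTheory GRing.Theory Num.Theory.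
Import numFieldNormedType.Exports.

Local Open Scope ring_scope.

(** * Softmax and the threshold *)

Section Softmax.
Context {R : realType} {q : nat}.
Hypothesis q3 : (3 <= q)%N.

Definition softmax (F : 'I_q -> R) (k : 'I_q) : R :=
  expR (F k) / \sum_(l < q) expR (F l).

Lemma sum_expR_gt0 (F : 'I_q -> R) : 0 < \sum_(l < q) expR (F l).
Proof.
have k0 : 'I_q by apply: (@Ordinal _ 0); apply: leq_trans q3.
rewrite (bigD1 k0) //= ltr_pwDl ?expR_gt0 //.
by rewrite sumr_ge0 // => l _; rewrite expR_ge0.
Qed.

Lemma softmax_ge0 (F : 'I_q -> R) k : 0 <= softmax F k.
Proof. by rewrite divr_ge0 ?expR_ge0 // ltW // sum_expR_gt0. Qed.

Lemma sum_softmax (F : 'I_q -> R) : \sum_(k < q) softmax F k = 1.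
Proof. by rewrite -mulr_suml divff // lt0r_neq0 // sum_expR_gt0. Qed.

Lemma sum_expR_others_ge (F : 'I_q -> R) (k : 'I_q) (a : R) :
  \sum_(l < q | l != k) F l = (q%:R - 1) * a ->
  (q%:R - 1) * expR a <= \sum_(l < q | l != k) expR (F l).
Proof.
move=> Fa.
have card (y : R) : \sum_(l < q | l != k) y = (q%:R - 1) * y.
  have : \sum_(l < q) y = q%:R * y by rewrite sumr_const card_ord mulr_natl.
  rewrite (bigD1 k) //=; lra.
(* Jensen: sum the tangent-line inequalities of [expR] at the mean [a] *)
have -> : (q%:R - 1) * expR a =
    \sum_(l < q | l != k) expR a * (1 + (F l - a)).
  by rewrite -mulr_sumr !big_split /= Fa sumrN !card; ring.
apply: ler_sum => l _.
rewrite [leRHS](_ : _ = expR a * expR (F l - a)); last first.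
  by rewrite -expRD; congr expR; ring.
by rewrite ler_pM2l ?expR_gt0 // expR_ge1Dx.
Qed.

(** Dividing by [expR (F k)] leaves the denominator [1 + \sum_(l != k) expR (F l - F k)]. Jensen
    replaces the other entries by their mean, and what results is increasing in [F k], so [F k] may
    be raised to [y]. *)
Lemma softmax_le (F : 'I_q -> R) (k : 'I_q) (y S : R) :
  \sum_(l < q) F l = S -> F k <= y ->
  softmax F k <= (1 + (q%:R - 1) * expR ((S - q%:R * y) / (q%:R - 1)))^-1.
Proof.
have Q3 : 3 <= q%:R :> R by rewrite ler_nat.
move=> FS Fy.
have Q1 : 0 < q%:R - 1 :> R by lra.
have -> : softmax F k = (\sum_(l < q) expR (F l - F k))^-1.
  rewrite /softmax -[LHS]invrK invf_div mulr_suml; congr (_^-1).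
  by apply: eq_bigr => l _; rewrite expRB.
have D0 : 0 < 1 + (q%:R - 1) * expR ((S - q%:R * y) / (q%:R - 1)).
  by rewrite addr_gt0 // mulr_gt0 ?expR_gt0.
have sub : (q%:R - 1) * expR ((S - q%:R * F k) / (q%:R - 1)) <=
     \sum_(l < q | l != k) expR (F l - F k).
  apply: sum_expR_others_ge.
  have : \sum_(l < q) (F l - F k) = S - q%:R * F k.
    by rewrite sumrB FS sumr_const card_ord mulr_natl.
  rewrite (bigD1 k) //= subrr add0r => ->; field; lra.
have le : 1 + (q%:R - 1) * expR ((S - q%:R * y) / (q%:R - 1)) <=
     \sum_(l < q) expR (F l - F k).
  rewrite (bigD1 k) //= subrr expR0 lerD2l; apply: le_trans sub.
  rewrite ler_pM2l // ler_expR ler_pM2r ?invr_gt0 //; nra.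
by rewrite lef_pV2 // posrE // (lt_le_trans D0).
Qed.

(** The slope [e^z - 1] of [e^z - z] is at most [e^r - 1] in absolute value on [[-r, r]], since
    [1 - e^-r <= e^r - 1]. Tangent lines at [x] and [y] stand in for the mean value theorem. *)
Lemma expR_sub_id_lip (r x y : R) : `|x| <= r -> `|y| <= r ->
  `|expR x - expR y - (x - y)| <= (expR r - 1) * `|x - y|.
Proof.
wlog xy : x y / y <= x.
  move=> H xr yr; case: (leP y x) => [|/ltW] h; first exact: H.
  rewrite (_ : _ - (x - y) = - (expR y - expR x - (y - x))); last by ring.
  by rewrite normrN [`|x - y|]distrC; exact: H.
rewrite !ler_norml => /andP[x1 x2] /andP[y1 y2].
have d0 : 0 <= x - y by rewrite subr_ge0.
rewrite (ger0_norm d0).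
have up : expR x - expR y <= expR x * (x - y).
  have : expR x * (1 + (y - x)) <= expR y.
    have {2}-> : y = x + (y - x) by ring.
    by rewrite expRD ler_pM2l ?expR_gt0 ?expR_ge1Dx.
  lra.
have lo : expR y * (x - y) <= expR x - expR y.
  have : expR y * (1 + (x - y)) <= expR x.
    have {2}-> : x = y + (x - y) by ring.
    by rewrite expRD ler_pM2l ?expR_gt0 ?expR_ge1Dx.
  lra.
have ex : expR x <= expR r by rewrite ler_expR.
have ey : 2 - expR r <= expR y.
  have : expR (- r) <= expR y by rewrite ler_expR.
  have e0 := expR_gt0 r; rewrite expRN.
  have : 2 - expR r <= (expR r)^-1.
    rewrite -(ler_pM2l e0) divff ?lt0r_neq0 //.
    have := sqr_ge0 (expR r - 1); rewrite expr2; lra.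
  lra.
have := ler_wpM2r d0 ex; have := ler_wpM2r d0 ey; move=> ??.
by apply/andP; split; lra.
Qed.

(** After shifting by the common mean [c], both normalizers are at least [q]. Because the totals
    agree, the linear parts cancel in [A F - A G], so changing the normalizer costs only
    [(expR r - 1) * D] and the constant tends to [1 / q] as [r] tends to 0. *)
Lemma softmax_lip (F G : 'I_q -> R) (c r : R) :
  \sum_(k < q) F k = q%:R * c -> \sum_(k < q) G k = q%:R * c ->
  (forall k, `|F k - c| <= r) -> (forall k, `|G k - c| <= r) ->
  \sum_(k < q) `|softmax F k - softmax G k| <=
    (2 * expR r - 1) / q%:R * \sum_(k < q) `|F k - G k|.
Proof.
have Q3 : 3 <= q%:R :> R by rewrite ler_nat.
move=> Fc Gc Fr Gr.
have shift (H : 'I_q -> R) k :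
    softmax H k = expR (H k - c) / \sum_(l < q) expR (H l - c).
  under eq_bigr => l _ do rewrite expRB.
  rewrite expRB -mulr_suml invfM invrK mulrACA mulVf ?mulr1 //.
  by rewrite gt_eqF // expR_gt0.
have card (a : R) : \sum_(k < q) a = q%:R * a.
  by rewrite sumr_const card_ord mulr_natl.
pose A (H : 'I_q -> R) := \sum_(l < q) expR (H l - c).
have Aq (H : 'I_q -> R) : \sum_(k < q) H k = q%:R * c -> q%:R <= A H.
  move=> Hc; have -> : (q%:R : R) = \sum_(l < q) (1 + (H l - c)).
    by rewrite big_split /= sumrB Hc !card; ring.
  by apply: ler_sum => l _; exact: expR_ge1Dx.
have Q0 : 0 < q%:R :> R by lra.
have AF := Aq F Fc; have AG := Aq G Gc.
set D := \sum_(k < q) `|F k - G k|.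
have D0 : 0 <= D by rewrite sumr_ge0.
have r0 : 0 <= r.
  have k0 : 'I_q by apply: (@Ordinal _ 0); apply: leq_trans q3.
  exact: le_trans (normr_ge0 _) (Fr k0).
have er : 1 <= expR r by rewrite -[leLHS]expR0 ler_expR.
pose E k := expR (F k - c) - expR (G k - c) - (F k - G k).
have El k : `|E k| <= (expR r - 1) * `|F k - G k|.
  rewrite /E -[X in _ - X](_ : F k - c - (G k - c) = _); last by ring.
  by rewrite -[X in _ * `|X|](_ : F k - c - (G k - c) = _);
    [exact: expR_sub_id_lip | ring].
have AFG : `|A F - A G| <= (expR r - 1) * D.
  have -> : A F - A G = \sum_(k < q) E k.
    rewrite /A /E -sumrB [RHS]sumrB; rewrite [X in _ = _ - X]sumrB Fc Gc.
    by rewrite subrr subr0.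
  apply: (le_trans (ler_norm_sum _ _ _)).
  by rewrite mulr_sumr; exact: ler_sum.
have A0 (H : 'I_q -> R) : q%:R <= A H -> 0 < A H.
  exact: lt_le_trans.
have step k : `|softmax F k - softmax G k| <=
    (`|F k - G k| * expR r + softmax G k * `|A F - A G|) / A F.
  have -> : softmax F k - softmax G k =
     (E k + (F k - G k) - softmax G k * (A F - A G)) / A F.
    rewrite /E !shift -!/(A _); field.
    by apply/andP; split; apply: lt0r_neq0; exact: A0.
  rewrite normrM normfV (gtr0_norm (A0 _ AF)) ler_pM2r ?invr_gt0 ?A0 //.
  apply: (le_trans (ler_normB _ _)).
  rewrite normrM (ger0_norm (softmax_ge0 _ _)) lerD2r.
  apply: (le_trans (ler_normD _ _)).
  have := El k; lra.
apply: (le_trans (ler_sum _ (fun k _ => step k))).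
rewrite -mulr_suml.
have -> : \sum_(k < q) (`|F k - G k| * expR r + softmax G k * `|A F - A G|) =
    D * expR r + `|A F - A G|.
  rewrite big_split /= /D mulr_suml; congr (_ + _).
  by rewrite -[RHS]mul1r -(sum_softmax G) mulr_suml.
rewrite [leRHS]mulrAC; apply: ler_pM.
- by rewrite addr_ge0 // mulr_ge0 // expR_ge0.
- by rewrite invr_ge0 ltW // A0.
- lra.
- by rewrite lef_pV2 ?posrE ?A0 //; lra.
Qed.

End Softmax.

(** * The scalar mean-field map below the threshold *)

Section Threshold.
Context {R : realType} {q : nat}.
Hypothesis q3 : (3 <= q)%N.

(** The mean-field heat-bath probability of a colour with proportion [x] when the other colours
    share [1 - x] equally. *)
Definition potts_map (b x : R) : R :=
  (1 + (q%:R - 1) * expR (2 * b * ((1 - q%:R * x) / (q%:R - 1))))^-1.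

Lemma potts_denom_gt0 (b x : R) :
  0 < 1 + (q%:R - 1) * expR (2 * b * ((1 - q%:R * x) / (q%:R - 1))).
Proof.
have Q3 : 3 <= q%:R :> R by rewrite ler_nat.
rewrite addr_gt0 // mulr_gt0 ?expR_gt0 //; lra. Qed.

Lemma continuous_potts_gap (b : R) :
  continuous (fun x => potts_map b x - x).
Proof.
move=> x; apply: cvgB; last exact: cvg_id.
apply: cvgV; first by apply: lt0r_neq0; exact: potts_denom_gt0.
apply: cvgD; first exact: cvg_cst.
apply: cvgMl_tmp.
apply: continuous_comp; last exact: continuous_expR.
apply: cvgMl_tmp; apply: cvgMr_tmp; apply: cvgB; first exact: cvg_cst.
by apply: cvgMl_tmp; exact: cvg_id.
Qed.

(** The map lies below the diagonal at 1. If it reached the diagonal at [x], the intermediate value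
    theorem would give a fixed point in [(1/q, 1)], which membership in [beta_s_set] excludes. *)
Lemma potts_map_lt (b x : R) : beta_s_set R q b ->
  q%:R^-1 < x -> x <= 1 -> potts_map b x < x.
Proof.
have Q3 : 3 <= q%:R :> R by rewrite ler_nat.
move=> [b0 nz] qx x1.
have f1 : potts_map b 1 - 1 < 0.
  rewrite subr_lt0 /potts_map invf_lt1 ?potts_denom_gt0 //.
  rewrite ltrDl mulr_gt0 ?expR_gt0 //; lra.
rewrite ltNge; apply/negP => xf.
have [||c] := @IVT R (fun x => potts_map b x - x) x 1 0 x1.
- by apply: continuous_subspaceT; exact: continuous_potts_gap.
- by rewrite ge_min le_max subr_ge0 xf (ltW f1) orbT.
rewrite in_itv /= => /andP[xc c1] fc0.
have c1' : c < 1.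
  by rewrite lt_neqAle c1 andbT; apply/eqP => E; move: f1; rewrite -E fc0 ltxx.
have := nz c (lt_le_trans qx xc) c1'.
by rewrite -/(potts_map b c) fc0 eqxx.
Qed.

Lemma lt_beta_s_set (b : R) : b < beta_s R q ->
  exists2 b', beta_s_set R q b' & b < b'.
Proof. by move=> bs; apply: sup_gt bs; case: (@beta_s_has_sup R q q3). Qed.

(* The slope of [potts_map b] at its fixed point [1 / q] is [2 b / q]. *)
Lemma beta_s_slope (b : R) : b < beta_s R q -> 2 * b < q%:R.
Proof.
have Q3 : 3 <= q%:R :> R by rewrite ler_nat.
move=> /lt_beta_s_set[b' b's bb']; apply: (@lt_le_trans _ _ (2 * b')).
  lra.
rewrite leNgt; apply/negP => qb.
(* Assume [q < 2 b']. At the point [x] with [q x - 1 = (q - 1) t], the inequality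
   [x <= potts_map b' x] amounts to [1 + (q - 1) t <= e (1 - t)] with [e = expR (2 b' t)]. The
   choice [2 b' (1 - t) = q] makes it follow from [1 + 2 b' t <= e]. *)
pose t := 1 - q%:R / (2 * b').
have B0 : 0 < 2 * b' by lra.
have tb : 2 * b' * t = 2 * b' - q%:R by rewrite /t; field; lra.
have t0 : 0 < t by rewrite subr_gt0 ltr_pdivrMr ?mul1r.
have t1 : t < 1 by rewrite ltrBlDr ltrDl divr_gt0 //; lra.
pose x := (1 + (q%:R - 1) * t) / q%:R.
have xq : q%:R * x = 1 + (q%:R - 1) * t by rewrite /x; field; lra.
have Q0 : 0 < q%:R :> R by lra.
have qx : q%:R^-1 < x.
  by rewrite -(ltr_pM2l Q0) xq divff ?lt0r_neq0 //; nra.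
have x1 : x <= 1 by rewrite -(ler_pM2l Q0) xq; nra.
have := potts_map_lt b' x b's qx x1; clearbody x t; rewrite /potts_map.
rewrite (_ : 2 * b' * ((1 - _) / _) = - (2 * b' * t)); last first.
  by rewrite xq; field; lra.
rewrite expRN; set e := expR _.
have e0 : 0 < e by exact: expR_gt0.
have e1 : 1 + 2 * b' * t <= e by exact: expR_ge1Dx.
have D0 : 0 < 1 + (q%:R - 1) * e^-1.
  by rewrite addr_gt0 // mulr_gt0 ?invr_gt0 //; lra.
rewrite -(ltr_pM2l D0) divff ?lt0r_neq0 // -(ltr_pM2l Q0) mulr1.
rewrite mulrCA xq -(ltr_pM2l e0).
rewrite [ltRHS](_ : _ = (e + (q%:R - 1)) * (1 + (q%:R - 1) * t)); last first.
  by field; exact: lt0r_neq0.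
rewrite tb in e1.
apply/negP; rewrite -leNgt.
have : (q%:R - 1) * (1 - t) * (e - (1 + 2 * b' * t)) >= 0.
  by rewrite mulr_ge0 ?mulr_ge0 ?subr_ge0 ?tb //; lra.
have : t * (2 * b' * t) = t * (2 * b' - q%:R) by rewrite tb.
nra.
Qed.

(** Some [b' > b] lies in [beta_s_set], and for [x > 1/q] the map increases with [b], so it is
    strictly below the diagonal for [b] too. By continuity the gap attains a positive minimum on the
    compact interval. *)
Lemma potts_map_gap (b eps : R) : 0 < b -> b < beta_s R q -> 0 < eps ->
  exists2 kappa, 0 < kappa &
    forall x, q%:R^-1 + eps <= x -> x <= 1 -> potts_map b x <= x - kappa.
Proof.
have Q3 : 3 <= q%:R :> R by rewrite ler_nat.
move=> b0 /lt_beta_s_set[b' b's bb'] eps0.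
have lt x : q%:R^-1 < x -> x <= 1 -> potts_map b x < x.
  move=> qx x1; apply: le_lt_trans (potts_map_lt b' x b's qx x1).
  rewrite /potts_map lef_pV2 ?posrE ?potts_denom_gt0 //.
  rewrite lerD2l ler_pM2l; last by lra.
  rewrite ler_expR.
  have : (1 - q%:R * x) / (q%:R - 1) <= 0.
    rewrite pmulr_lle0 ?invr_gt0; last by lra.
    rewrite subr_le0 -(@ler_pM2l _ (q%:R^-1)) ?invr_gt0; last by lra.
    by rewrite mulKf ?mulr1 ?ltW ?lt0r_neq0 //; lra.
  nra.
case: (leP (q%:R^-1 + eps) 1) => [e1|e1]; last first.
  exists 1 => // x ex x1.
  by have := lt_le_trans e1 (le_trans ex x1); rewrite ltxx.
have [|c] := @EVT_max R (fun x => potts_map b x - x) _ _ e1.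
  by apply: continuous_subspaceT; exact: continuous_potts_gap.
rewrite in_itv /= => /andP[c1 c2] H.
exists (c - potts_map b c).
  by rewrite subr_gt0 lt //; lra.
move=> x ex x1; have := H x; rewrite in_itv /= ex x1 => /(_ isT); lra.
Qed.

End Threshold.

(** * Averaging operators and maximal couplings *)

Section Averaging.
Context {R : realType}.

(** A Markov operator seen through its action on functions: monotone, linear, and fixing constants.
    [iter n O f x] plays the role of the expectation of [f] at time [n] from [x], so no path space
    is needed. *)
Definition averaging {T : Type} (O : (T -> R) -> T -> R) :=
  [/\ forall f g, (forall x, f x <= g x) -> forall x, O f x <= O g x,
      forall a f g x, O (fun y => a * f y + g y) x = a * O f x + O g x &
      forall c x, O (fun=> c) x = c].

Lemma averaging_iter {T : Type} (O : (T -> R) -> T -> R) n :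
  averaging O -> averaging (iter n O).
Proof.
move=> [mono lin cst]; elim: n => [|n [IHm IHl IHc]]; first by split.
split=> [f g fg x|a f g x|c x] /=.
- by apply: mono => y; exact: IHm.
- by rewrite -lin; congr (O _ x); apply/funext => y; exact: IHl.
- by rewrite -[RHS](cst c x); congr (O _ x); apply/funext => y; exact: IHc.
Qed.

Lemma averaging_drift {T : Type} (O : (T -> R) -> T -> R) (f : T -> R)
    (c d : R) n x :
  averaging O -> 0 < c -> c <= 1 -> 0 <= d ->
  (forall y, O f y <= (1 - c) * f y + d) ->
  iter n O f x <= (1 - c) ^+ n * f x + d / c.
Proof.
move=> avO c0 c1 d0 Of.
have c1' : 0 <= 1 - c by rewrite subr_ge0.
have dc0 : 0 <= d / c by rewrite divr_ge0 // ltW.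
elim: n => [|n IHn]; first by rewrite /= expr0 mul1r lerDl.
have [mono lin cst] := averaging_iter O n avO.
rewrite iterSr; apply: le_trans (mono _ (fun y => (1 - c) * f y + d) Of x) _.
rewrite lin cst exprS -mulrA.
apply: (@le_trans _ _ ((1 - c) * ((1 - c) ^+ n * f x + d / c) + d)).
  by rewrite lerD2r ler_wpM2l.
rewrite mulrDr -addrA lerD2l mulrBl mul1r mulrCA divff ?mulr1 ?lt0r_neq0 //.
by rewrite subrK.
Qed.

Lemma one_subX_le_expR (c : R) n : c <= 1 ->
  (1 - c) ^+ n <= expR (- (c * n%:R)).
Proof.
move=> c1; rewrite (_ : - (c * n%:R) = n%:R * - c); last by ring.
by rewrite expRM_natl lerXn2r ?nnegrE ?expR_ge0 ?subr_ge0 // expR_ge1Dx.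
Qed.

End Averaging.

(** * Maximal coupling of two laws on a finite set *)

Section MaximalCoupling.
Context {R : realType} {I : finType} (p p' : I -> R).
Hypothesis pp' : \sum_a p a = \sum_a p' a.

Definition overlap a := Num.min (p a) (p' a).

(** For probability vectors this is the total variation distance, as [excessE] makes explicit. *)
Definition excess : R := \sum_a (p a - overlap a).

(* For [p = p'] the quotient is [0 / 0 = 0], as it should be. *)
Definition max_coupling a b : R :=
  overlap a * (a == b)%:R +
  (p a - overlap a) * (p' b - overlap b) / excess.

Lemma excessE : excess = 2^-1 * \sum_a `|p a - p' a|.
Proof.
have -> : \sum_a `|p a - p' a| = \sum_a (p a - overlap a + (p' a - overlap a)).
  apply: eq_bigr => a _; rewrite /overlap; case: (leP (p a) (p' a)) => h.
    by rewrite ler0_norm ?subr_le0 //; ring.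
  by rewrite ger0_norm ?subr_ge0 ?(ltW h) //; ring.
by rewrite big_split /= !sumrB -pp' /excess sumrB; lra.
Qed.

Let overlap_l a : 0 <= p a - overlap a.
Proof. by rewrite subr_ge0 ge_min lexx. Qed.

Let overlap_r a : 0 <= p' a - overlap a.
Proof. by rewrite subr_ge0 ge_min lexx orbT. Qed.

Let excess_r : excess = \sum_a (p' a - overlap a).
Proof. by rewrite /excess !sumrB pp'. Qed.

Lemma excess_ge0 : 0 <= excess.
Proof. by rewrite sumr_ge0. Qed.

(** The cancellation survives [excess = 0], since the non-negative terms [f a] then all vanish. *)
Let excess_mul (f : I -> R) a : excess = \sum_a f a ->
  (forall a, 0 <= f a) -> f a * excess / excess = f a.
Proof.
move=> ef f0; have [e0|en0] := eqVneq excess 0; last by rewrite mulfK.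
rewrite e0 invr0 mulr0; rewrite ef in e0.
by rewrite (psumr_eq0P (fun a _ => f0 a) e0).
Qed.

Lemma max_coupling_suml a : \sum_b max_coupling a b = p a.
Proof.
rewrite big_split /= -mulr_suml -mulr_sumr -excess_r.
rewrite (excess_mul (fun a => p a - overlap a)) //.
rewrite (bigD1 a) //= eqxx mulr1 big1 ?addr0; first by rewrite subrKC.
by move=> b /negPf ab; rewrite eq_sym ab mulr0.
Qed.

Lemma max_coupling_sumr b : \sum_a max_coupling a b = p' b.
Proof.
rewrite big_split /= -mulr_suml -mulr_suml -/excess [excess * _]mulrC.
rewrite (excess_mul (fun a => p' a - overlap a)) //.
rewrite (bigD1 b) //= eqxx mulr1 big1 ?addr0; first by rewrite subrKC.
by move=> a /negPf ab; rewrite ab mulr0.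
Qed.

Lemma max_coupling_ge0 a b : (forall c, 0 <= p c) -> (forall c, 0 <= p' c) ->
  0 <= max_coupling a b.
Proof.
move=> p0 p'0; rewrite addr_ge0 ?mulr_ge0 ?invr_ge0 ?excess_ge0 //.
by rewrite le_min p0 p'0.
Qed.

(** The overlap term lives on the diagonal, and the product term has total mass [excess]. *)
Lemma max_coupling_neq :
  \sum_a \sum_b max_coupling a b * (a != b)%:R <= excess.
Proof.
have -> : excess =
    \sum_a \sum_b (p a - overlap a) * (p' b - overlap b) / excess.
  rewrite /excess; apply: eq_bigr => a _.
  rewrite -mulr_suml -mulr_sumr -/excess -excess_r.
  by rewrite (excess_mul (fun a => p a - overlap a)).
apply: ler_sum => a _; apply: ler_sum => b _; rewrite /max_coupling.
case: eqP => _ /=; last by rewrite mulr1 mulr0 add0r.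
by rewrite mulr0 !mulr_ge0 ?invr_ge0 ?excess_ge0.
Qed.

Lemma excess_le1 : \sum_a p a = 1 -> (forall a, 0 <= p a) ->
  (forall a, 0 <= p' a) -> excess <= 1.
Proof.
move=> p1 p0 p'0; rewrite -p1; apply: ler_sum => a _.
by rewrite gerBl le_min p0 p'0.
Qed.

End MaximalCoupling.

(** * The coupled heat-bath dynamics *)

Section Dynamics.
Context {R : realType} {q m N : nat} {lam J beta : R}.
Hypotheses (q3 : (3 <= q)%N) (m_gt0 : (0 < m)%N) (N_gt0 : (0 < N)%N).
Hypotheses (lam_gt0 : 0 < lam) (J_gt0 : 0 < J) (beta_gt0 : 0 < beta).

Local Notation vert := (vertex m N).
Local Notation conf := (config q m N).
Local Notation acoup := (interaction lam J).
Local Notation n := (m%:R * N%:R : R).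

Definition coupling_const (i j : 'I_m) : R :=
  if i == j then J / (1 + (m%:R - 1) * lam)
  else J * lam / (1 + (m%:R - 1) * lam).

Let m1 : 1 <= m%:R :> R. Proof. by rewrite ler1n. Qed.

Let D_ge1 : 1 <= 1 + (m%:R - 1) * lam.
Proof. by rewrite lerDl mulr_ge0 ?subr_ge0 // ltW. Qed.

Let D_gt0 : 0 < 1 + (m%:R - 1) * lam.
Proof. exact: lt_le_trans ltr01 D_ge1. Qed.

Let NR_gt0 : 0 < N%:R :> R. Proof. by rewrite ltr0n. Qed.

Let mR_gt0 : 0 < m%:R :> R. Proof. by rewrite ltr0n. Qed.

Lemma coupling_const_ge0 i j : 0 <= coupling_const i j.
Proof.
have Di : 0 <= (1 + (m%:R - 1) * lam)^-1 by rewrite invr_ge0 ltW.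
by rewrite /coupling_const; case: ifP => _; rewrite !mulr_ge0 // ltW.
Qed.

Lemma coupling_constC i j : coupling_const i j = coupling_const j i.
Proof. by rewrite /coupling_const eq_sym. Qed.

(** The normalization of the interaction makes every row sum equal to [J]; this is why [m] and [lam]
    drop out of the threshold and only [beta * J] remains. *)
Lemma sum_coupling_const i : \sum_j coupling_const i j = J.
Proof.
rewrite (bigD1 i) //= {1}/coupling_const eqxx.
rewrite (eq_bigr (fun=> J * lam / (1 + (m%:R - 1) * lam))); last first.
  by move=> j /negPf ji; rewrite /coupling_const eq_sym ji.
have card : \sum_(j < m | j != i) (1 : R) = m%:R - 1.
  have : \sum_(j < m) (1 : R) = m%:R by rewrite sumr_const card_ord.
  by rewrite (bigD1 i) //= => <-; ring.
rewrite -[X in _ + X](_ : (\sum_(j < m | j != i) (1 : R)) *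
    (J * lam / (1 + (m%:R - 1) * lam)) = _); last first.
  by rewrite mulr_suml; apply: eq_bigr => j _; rewrite mul1r.
by rewrite card; field; exact: lt0r_neq0.
Qed.

Lemma coupling_const_diag i : coupling_const i i <= J.
Proof.
rewrite /coupling_const eqxx ler_pdivrMr // ler_peMr //; exact: ltW.
Qed.

Lemma interactionE (v w : vert) : acoup v w = coupling_const v.1 w.1.
Proof. by []. Qed.

Lemma sum_vertex (F : vert -> R) : \sum_v F v = \sum_i \sum_u F (i, u).
Proof. by rewrite pair_bigA; apply: eq_bigr => -[]. Qed.

Lemma sum_interaction (v : vert) : \sum_w acoup v w = N%:R * J.
Proof.
rewrite sum_vertex -[X in _ = _ * X](sum_coupling_const v.1) mulr_sumr.
apply: eq_bigr => j _; rewrite (eq_bigr (fun=> coupling_const v.1 j)) //.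
by rewrite sumr_const card_ord mulr_natl.
Qed.

(* The self-interaction at [v] cancels in the conditional law. *)
Definition field (s : conf) (v : vert) (k : 'I_q) : R :=
  2 * beta / N%:R * \sum_(w | w != v) acoup v w * (s w == k)%:R.

Definition heat (s : conf) (v : vert) (k : 'I_q) : R := softmax (field s v) k.

Definition upd (s : conf) (v : vert) (k : 'I_q) : conf :=
  [ffun w => if w == v then k else s w].

Lemma heat_ge0 s v k : 0 <= heat s v k.
Proof. exact: softmax_ge0. Qed.

Lemma sum_heat s v : \sum_k heat s v k = 1.
Proof. exact: sum_softmax. Qed.

Lemma heat_le1 s v k : heat s v k <= 1.
Proof.
rewrite -(sum_heat s v) (bigD1 k) //= lerDl sumr_ge0 // => l _.
exact: heat_ge0.
Qed.

Lemma upd_id s v k : upd s v k v = k.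
Proof. by rewrite ffunE eqxx. Qed.

Lemma agree_offP v (s t : conf) : agree_off v s t = (t == upd s v (t v)).
Proof.
apply/forallP/eqP => [st|-> w]; last first.
  by apply/implyP => /negPf wv; rewrite ffunE wv.
apply/ffunP => w; rewrite ffunE; case: (eqVneq w v) => [->//|wv].
by have /implyP/(_ wv)/eqP := st w.
Qed.

Lemma agree_off_upd v s k : agree_off v s (upd s v k).
Proof. by rewrite agree_offP upd_id. Qed.

(** Every pair [(v, w)] with [w != v] occurs in both orders, whence the factor 2 in [field]. The
    diagonal term at [v] and the pairs avoiding [v] do not depend on [k] and go into the
    constant. *)
Lemma gibbs_weight_upd (s : conf) v : exists2 c : R, 0 < c &
  forall k, gibbs_weight lam J beta (upd s v k) = c * expR (field s v k).
Proof.
pose rest := acoup v v + \sum_(x : vert | x != v) \sum_(y : vert | y != v)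
   acoup x y * (s x == s y)%:R.
exists (expR (beta / N%:R * rest)); first exact: expR_gt0.
move=> k; rewrite /gibbs_weight -expRD; congr expR.
set S := \sum_(w | w != v) acoup v w * (s w == k)%:R.
have -> : field s v k = beta / N%:R * (2 * S).
  by rewrite /field -/S; ring.
rewrite -mulrDr; congr (_ * _).
rewrite (bigD1 v) //= (bigD1 v) //= upd_id eqxx mulr1.
have -> : \sum_(w : vert | w != v) acoup v w * (k == upd s v k w)%:R = S.
  by apply: eq_bigr => w /negPf wv; rewrite ffunE wv eq_sym.
have -> : \sum_(x : vert | x != v) \sum_(w : vert)
     acoup x w * (upd s v k x == upd s v k w)%:R =
   S + \sum_(x : vert | x != v) \sum_(y : vert | y != v)
     acoup x y * (s x == s y)%:R.
  rewrite -big_split /=; apply: eq_bigr => x xv.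
  rewrite (bigD1 v) //= upd_id ffunE (negPf xv); congr (_ + _).
    by rewrite !interactionE coupling_constC.
  by apply: eq_bigr => y yv; rewrite ffunE (negPf yv).
by rewrite /rest; ring.
Qed.

Lemma partition_function_gt0 : 0 < partition_function q m N lam J beta.
Proof.
have k0 : 'I_q := Ordinal (leq_trans (isT : (0 < 3)%N) q3).
rewrite /partition_function (bigD1 [ffun=> k0]) //= ltr_pwDl ?expR_gt0 //.
by rewrite sumr_ge0 // => s _; exact: expR_ge0.
Qed.

Lemma gibbs_gt0 (s : conf) : 0 < gibbs lam J beta s.
Proof. by rewrite divr_gt0 ?expR_gt0 // partition_function_gt0. Qed.

Lemma sum_gibbs : \sum_(s : conf) gibbs lam J beta s = 1.
Proof.
by rewrite -mulr_suml divff // lt0r_neq0 // partition_function_gt0.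
Qed.

Lemma sum_agree_off (f : conf -> R) s v :
  \sum_(u | agree_off v s u) f u = \sum_k f (upd s v k).
Proof.
rewrite (reindex_onto (upd s v) (fun u => u v)) => [|u]; last first.
  by rewrite agree_offP => /eqP.
by apply: eq_bigl => k; rewrite agree_off_upd upd_id eqxx.
Qed.

Lemma resample_upd s v k : resample lam J beta v s (upd s v k) = heat s v k.
Proof.
rewrite /resample agree_off_upd sum_agree_off.
have [c c0 E] := gibbs_weight_upd s v.
rewrite /gibbs -mulr_suml E (eq_bigr _ (fun k _ => E k)) -mulr_sumr.
rewrite /heat /softmax.
have Z0 := partition_function_gt0; have S0 := sum_expR_gt0 q3 (field s v).
by field; rewrite ?lt0r_neq0.
Qed.

Definition glauber_op (f : conf -> R) (s : conf) : R :=
  n^-1 * \sum_v \sum_k heat s v k * f (upd s v k).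

Lemma glauber_opE f s :
  \sum_t glauber lam J beta s t * f t = glauber_op f s.
Proof.
rewrite /glauber /glauber_op card_prod !card_ord natrM.
under eq_bigr => t _ do rewrite -mulrA mulr_suml.
rewrite -mulr_sumr exchange_big /=; congr (_ * _); apply: eq_bigr => v _.
rewrite (bigID (agree_off v s)) /= [X in _ + X]big1 ?addr0; last first.
  by move=> t /negPf st; rewrite /resample st mul0r.
by rewrite sum_agree_off; apply: eq_bigr => k _; rewrite resample_upd.
Qed.

(** Passes from laws to test functions, where the chain is the iteration of an averaging
    operator. *)
Lemma glauber_law_iter f s (j : nat) :
  \sum_t glauber_law lam J beta s j t * f t = iter j glauber_op f s.
Proof.
elim: j f => [|j IHj] f.
  rewrite (bigD1 s) //= eqxx mul1r big1 ?addr0 // => t /negPf ts.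
  by rewrite eq_sym ts mul0r.
rewrite iterSr -IHj /=; under eq_bigr => t _ do rewrite mulr_suml.
rewrite exchange_big /=; apply: eq_bigr => u _.
by rewrite -glauber_opE mulr_sumr; apply: eq_bigr => t _; rewrite mulrA.
Qed.

(** Only configurations agreeing with [t] off [v] contribute, and they share one normalizer, which
    cancels against the sum of their Gibbs weights. *)
Lemma resample_gibbs v (t : conf) :
  \sum_s gibbs lam J beta s * resample lam J beta v s t = gibbs lam J beta t.
Proof.
have sym s : agree_off v s t = agree_off v t s.
  by apply: eq_forallb => w; rewrite [s w == _]eq_sym.
have Zeq s : agree_off v s t ->
    \sum_(u | agree_off v s u) gibbs lam J beta u =
    \sum_(u | agree_off v t u) gibbs lam J beta u.
  rewrite !sum_agree_off agree_offP => /eqP ->; apply: eq_bigr => k _.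
  by congr gibbs; apply/ffunP => w; rewrite !ffunE; case: ifP.
have Z0 : 0 < \sum_(u | agree_off v t u) gibbs lam J beta u.
  rewrite (bigD1 t) ?ltr_pwDl ?gibbs_gt0 ?sumr_ge0 //=.
    by move=> u _; rewrite ltW ?gibbs_gt0.
  by apply/forallP => w; rewrite eqxx implybT.
rewrite (bigID (agree_off v t)) /= [X in _ + X]big1 ?addr0; last first.
  by move=> s /negPf ts; rewrite /resample sym ts mulr0.
rewrite (eq_bigr (fun s => gibbs lam J beta s *
   (gibbs lam J beta t / \sum_(u | agree_off v t u) gibbs lam J beta u))).
  by rewrite -mulr_suml mulrCA divff ?mulr1 ?lt0r_neq0.
by move=> s ts; rewrite /resample sym ts Zeq // sym.
Qed.

Lemma n_gt0 : 0 < n. Proof. by rewrite mulr_gt0. Qed.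

Lemma sum_ord_const (p : nat) (a : R) : \sum_(i < p) a = p%:R * a.
Proof. by rewrite sumr_const card_ord mulr_natl. Qed.

Lemma sum_vertex_const (a : R) : \sum_(v : vert) a = n * a.
Proof. by rewrite sumr_const card_prod !card_ord -natrM mulr_natl. Qed.

Lemma glauber_op_gibbs f :
  \sum_s gibbs lam J beta s * glauber_op f s = \sum_s gibbs lam J beta s * f s.
Proof.
under eq_bigr => s _ do rewrite -glauber_opE mulr_sumr.
rewrite exchange_big /=; apply: eq_bigr => t _.
under eq_bigr => s _ do rewrite mulrA.
rewrite -mulr_suml; congr (_ * _).
rewrite /glauber card_prod !card_ord natrM.
under eq_bigr => s _ do rewrite mulrCA mulr_sumr.
rewrite -mulr_sumr exchange_big /=.
rewrite (eq_bigr _ (fun v _ => resample_gibbs v t)) sum_vertex_const mulrA.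
by rewrite mulVf ?mul1r ?lt0r_neq0 ?n_gt0.
Qed.

Lemma iter_glauber_op_gibbs f (j : nat) :
  \sum_s gibbs lam J beta s * iter j glauber_op f s =
  \sum_s gibbs lam J beta s * f s.
Proof. by elim: j => // j IHj; rewrite /= glauber_op_gibbs. Qed.

Lemma glauber_op_averaging : averaging glauber_op.
Proof.
have n0 := n_gt0.
split=> [f g fg s|a f g s|c s]; rewrite /glauber_op.
- rewrite ler_pM2l ?invr_gt0 //; apply: ler_sum => v _.
  by apply: ler_sum => k _; rewrite ler_wpM2l ?heat_ge0.
- rewrite mulrCA -mulrDr; congr (_ * _); rewrite mulr_sumr -big_split /=.
  apply: eq_bigr => v _; rewrite mulr_sumr -big_split /=.
  by apply: eq_bigr => k _; ring.
- under eq_bigr => v _ do rewrite -mulr_suml sum_heat mul1r.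
  by rewrite sum_vertex_const mulKf ?lt0r_neq0.
Qed.

(** * The coupled chain and the Hamming distance *)

Definition coupled_op (f : conf * conf -> R) (x : conf * conf) : R :=
  n^-1 * \sum_v \sum_a \sum_b
    max_coupling (heat x.1 v) (heat x.2 v) a b * f (upd x.1 v a, upd x.2 v b).

Let heat12 (x : conf * conf) v :
  \sum_k heat x.1 v k = \sum_k heat x.2 v k.
Proof. by rewrite !sum_heat. Qed.

Lemma max_coupling_heat_ge0 (s t : conf) v a b :
  0 <= max_coupling (heat s v) (heat t v) a b.
Proof. by apply: max_coupling_ge0 => *; exact: heat_ge0. Qed.

Lemma coupled_op_fst (f : conf -> R) x :
  coupled_op (fun y => f y.1) x = glauber_op f x.1.
Proof.
congr (_ * _); apply: eq_bigr => v _; apply: eq_bigr => a _ /=.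
by rewrite -mulr_suml max_coupling_suml.
Qed.

Lemma coupled_op_snd (f : conf -> R) x :
  coupled_op (fun y => f y.2) x = glauber_op f x.2.
Proof.
congr (_ * _); apply: eq_bigr => v _; rewrite exchange_big /=.
by apply: eq_bigr => b _; rewrite -mulr_suml max_coupling_sumr.
Qed.

Lemma coupled_op_averaging : averaging coupled_op.
Proof.
have n0 := n_gt0.
split=> [f g fg x|c f g x|c x].
- rewrite ler_pM2l ?invr_gt0 //; apply: ler_sum => v _.
  apply: ler_sum => a _; apply: ler_sum => b _.
  by rewrite ler_wpM2l ?max_coupling_heat_ge0.
- rewrite /coupled_op mulrCA -mulrDr; congr (_ * _).
  rewrite mulr_sumr -big_split /=.
  apply: eq_bigr => v _; rewrite mulr_sumr -big_split /=.
  apply: eq_bigr => a _; rewrite mulr_sumr -big_split /=.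
  by apply: eq_bigr => b _; ring.
- have [_ _ cst] := glauber_op_averaging.
  by rewrite (coupled_op_fst (fun=> c)) cst.
Qed.

Lemma iter_coupled_op_fst (f : conf -> R) j x :
  iter j coupled_op (fun y => f y.1) x = iter j glauber_op f x.1.
Proof.
elim: j f => // j IHj f; rewrite !iterSr -IHj; congr (iter j _ _ x).
by apply/funext => y; exact: coupled_op_fst.
Qed.

Lemma iter_coupled_op_snd (f : conf -> R) j x :
  iter j coupled_op (fun y => f y.2) x = iter j glauber_op f x.2.
Proof.
elim: j f => // j IHj f; rewrite !iterSr -IHj; congr (iter j _ _ x).
by apply/funext => y; exact: coupled_op_snd.
Qed.

Definition hamming (x : conf * conf) : R := \sum_v (x.1 v != x.2 v)%:R.

Lemma hamming_ge0 x : 0 <= hamming x.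
Proof. by rewrite sumr_ge0. Qed.

Lemma hamming_le x : hamming x <= n.
Proof.
rewrite -[leRHS]mulr1 -sum_vertex_const; apply: ler_sum => v _.
by case: (_ != _).
Qed.

(** Resampling [v] erases a disagreement there, and creates one with probability at most the total
    variation distance of the two heat-bath laws. Averaging over the [n] vertices gives the
    bound. *)
Lemma coupled_op_hamming x :
  coupled_op hamming x <= (1 - n^-1) * hamming x +
    n^-1 * \sum_v excess (heat x.1 v) (heat x.2 v).
Proof.
have n0 := n_gt0.
have updH v a b : hamming (upd x.1 v a, upd x.2 v b) =
    hamming x - (x.1 v != x.2 v)%:R + (a != b)%:R.
  rewrite /hamming (bigD1 v) //= [X in _ = X - _ + _](bigD1 v) //= !upd_id.
  rewrite (eq_bigr (fun w => (x.1 w != x.2 w)%:R)) => [|w /negPf wv].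
    by ring.
  by rewrite !ffunE wv.
rewrite mulrBl mul1r -{1}[hamming x](mulKf (lt0r_neq0 n0)).
rewrite -addrA [- _ + _]addrC.
rewrite -mulrBr -mulrDr ler_pM2l ?invr_gt0 //.
rewrite -sum_vertex_const {3}/hamming -sumrB -big_split /=.
apply: ler_sum => v _.
under eq_bigr => a _ do under eq_bigr => b _ do rewrite updH mulrDr.
under eq_bigr => a _ do rewrite big_split /= -mulr_suml max_coupling_suml //.
rewrite big_split /= -mulr_suml sum_heat mul1r.
have := max_coupling_neq (heat x.1 v) (heat x.2 v) (heat12 x v).
set A := \sum_a _; set E := excess _ _; lra.
Qed.

(** The second copy is started from the stationary law. Indicators of sets differ by at most the
    Hamming distance, so its expectation bounds the difference of probabilities of any set [A]. *)
Lemma total_variation_gibbs (s : conf) j :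
  (forall x, iter j coupled_op hamming x <= 4^-1) ->
  Defs.total_variation (glauber_law lam J beta s j) (gibbs lam J beta) <= 4^-1.
Proof.
move=> H; rewrite /Defs.total_variation; apply: bigmax_le => [|A _].
  by rewrite invr_ge0.
pose f (t : conf) : R := (t \in A)%:R.
have fsum (P : conf -> R) : \sum_(t in A) P t = \sum_t P t * f t.
  rewrite big_mkcond /=; apply: eq_bigr => t _; rewrite /f.
  by case: ifP => _; rewrite ?mulr1 ?mulr0.
have [mono lin _] := averaging_iter _ j coupled_op_averaging.
have fH (x : conf * conf) : `|f x.1 - f x.2| <= hamming x.
  case: (eqVneq x.1 x.2) => [->|x12]; first by rewrite subrr normr0 hamming_ge0.
  have [v xv] : exists v, x.1 v != x.2 v.
    apply/existsP; rewrite -negb_forall; apply: contra x12 => /forallP x12.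
    by apply/eqP/ffunP => v; exact/eqP.
  apply: (@le_trans _ _ 1); last first.
    by rewrite /hamming (bigD1 v) //= xv lerDl sumr_ge0.
  by rewrite /f; do 2 case: (_ \in A);
    rewrite ?subrr ?normr0 ?subr0 ?sub0r ?normrN ?normr1.
have close x : `|iter j glauber_op f x.1 - iter j glauber_op f x.2| <= 4^-1.
  (* Both marginal expectations are read as expectations of the coupled chain, where monotonicity
     applies to the difference. *)
  have lip (g h : conf -> R) y :
     (forall z : conf * conf, g z.1 - h z.2 <= hamming z) ->
     iter j glauber_op g y.1 - iter j glauber_op h y.2 <= 4^-1.
    move=> gh; rewrite -iter_coupled_op_fst -iter_coupled_op_snd.
    rewrite -mulN1r addrC -lin; apply: le_trans (H y); apply: mono => z.
    by rewrite mulN1r addrC.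
  rewrite ler_norml lerNl opprB; apply/andP; split.
    apply: (lip f f (x.2, x.1)) => z; exact: le_trans (ler_norm _) (fH z).
  by apply: (lip f f x) => z; exact: le_trans (ler_norm _) (fH z).
(* By stationarity the Gibbs mass of [A] is the Gibbs average over starting points [t] of the
   time-[j] expectation of [f]; the first term is averaged over the same [t] trivially. *)
rewrite !fsum glauber_law_iter -(iter_glauber_op_gibbs f j).
rewrite -[X in X - _]mul1r -[X in X * _ - _]sum_gibbs mulr_suml -sumrB.
apply: (le_trans (ler_norm_sum _ _ _)).
rewrite [leRHS](_ : _ = \sum_(t : conf) gibbs lam J beta t * 4^-1); last first.
  by rewrite -mulr_suml sum_gibbs mul1r.
apply: ler_sum => t _; have g0 := gibbs_gt0 t.
rewrite -mulrBr normrM (gtr0_norm g0) ler_pM2l //.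
exact: (close (s, t)).
Qed.

(** * Drift of the colour counts and of the Hamming distance *)

Definition cnt (s : conf) (i : 'I_m) (k : 'I_q) : R :=
  \sum_(u < N) (s (i, u) == k)%:R.

Lemma cnt_ge0 s i k : 0 <= cnt s i k.
Proof. by rewrite sumr_ge0. Qed.

Lemma cnt_le s i k : cnt s i k <= N%:R.
Proof.
have -> : N%:R = \sum_(u < N) (1 : R) by rewrite sum_ord_const mulr1.
by apply: ler_sum => u _; case: (_ == _).
Qed.

Lemma sum_in_component (f : vert -> R) i :
  \sum_v (v.1 == i)%:R * f v = \sum_(u < N) f (i, u).
Proof.
rewrite sum_vertex (bigD1 i) //= [X in _ + X]big1 ?addr0 => [|j /negPf ji].
  by apply: eq_bigr => u _; rewrite eqxx mul1r.
by rewrite big1 // => u _; rewrite ji mul0r.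
Qed.

Lemma cnt_upd s v a i k : cnt (upd s v a) i k =
  cnt s i k + (v.1 == i)%:R * ((a == k)%:R - (s v == k)%:R).
Proof.
have cntE t : cnt t i k = \sum_w (w.1 == i)%:R * (t w == k)%:R.
  by rewrite sum_in_component.
rewrite !cntE (bigD1 v) //= [in RHS](bigD1 v) //= upd_id.
rewrite (eq_bigr (fun w => (w.1 == i)%:R * (s w == k)%:R)) => [|w /negPf wv].
  by ring.
by rewrite ffunE wv.
Qed.

Local Notation b := (beta * J).

Let b_gt0 : 0 < b. Proof. exact: mulr_gt0. Qed.

(** Restoring the omitted non-negative self-term completes the row sum to [J]. *)
Lemma field_le s v k (M : R) : (forall j, cnt s j k <= N%:R * M) ->
  field s v k <= 2 * b * M.
Proof.
move=> cM.
have NR : 0 < N%:R :> R := NR_gt0.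
have -> : 2 * b * M = 2 * beta / N%:R * (J * (N%:R * M)).
  by field; exact: lt0r_neq0.
rewrite ler_pM2l ?divr_gt0 ?mulr_gt0 //.
rewrite -[X in _ <= X * _](sum_coupling_const v.1) mulr_suml.
apply: (@le_trans _ _ (\sum_w acoup v w * (s w == k)%:R)).
  by rewrite [leRHS](bigD1 v) //= lerDr mulr_ge0 // coupling_const_ge0.
rewrite sum_vertex; apply: ler_sum => j _.
rewrite (eq_bigr (fun u => coupling_const v.1 j * (s (j, u) == k)%:R)) //.
by rewrite -mulr_sumr ler_wpM2l ?coupling_const_ge0 //; exact: cM.
Qed.

Lemma sum_indicator (a : 'I_q) : \sum_(k < q) (a == k)%:R = 1 :> R.
Proof.
rewrite (bigD1 a) //= eqxx big1 ?addr0 // => k /negPf ka.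
by rewrite eq_sym ka.
Qed.

Lemma sum_field s v :
  \sum_k field s v k = 2 * b - 2 * beta / N%:R * coupling_const v.1 v.1.
Proof.
rewrite -mulr_sumr exchange_big /=.
rewrite (eq_bigr (acoup v)) => [|w _]; last first.
  by rewrite -mulr_sumr sum_indicator mulr1.
have := sum_interaction v; rewrite (bigD1 v) //= => /(canRL (addKr _)) ->.
by rewrite interactionE; field; rewrite lt0r_neq0.
Qed.

Lemma self_field_bound (i : 'I_m) :
  0 <= 2 * beta / N%:R * coupling_const i i <= 2 * b / N%:R.
Proof.
have c0 : 0 < 2 * beta / N%:R by rewrite divr_gt0 ?mulr_gt0.
rewrite mulr_ge0 ?coupling_const_ge0 ?(ltW c0) //=.
rewrite [leRHS](_ : _ = 2 * beta / N%:R * J); last by ring.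
by rewrite ler_pM2l // coupling_const_diag.
Qed.

(** The missing self-interaction [d] lowers the total field and multiplies the exponential in
    [potts_map] by [expR (- eta)], with [eta = d / (q - 1)]. This changes the inverse by at most
    [eta], hence by at most [2 b / N]. *)
Lemma heat_le s v k (M : R) : (forall j, cnt s j k <= N%:R * M) ->
  heat s v k <= potts_map (q := q) b M + 2 * b / N%:R.
Proof.
move=> cM; have Q3 : 3 <= q%:R :> R by rewrite ler_nat.
have := softmax_le q3 (field s v) k _ _ (sum_field s v) (field_le s v k M cM).
move=> /le_trans; apply.
have /andP[] := self_field_bound v.1.
set d := _ * coupling_const _ _ => d0 dN.
pose eta := d / (q%:R - 1).
have eta0 : 0 <= eta by rewrite divr_ge0 //; lra.
have etaN : eta <= 2 * b / N%:R.
  by apply: le_trans dN; rewrite ler_pdivrMr ?ler_peMr //; lra.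
rewrite (_ : (_ - _) / (_ - 1) =
    2 * b * ((1 - q%:R * M) / (q%:R - 1)) - eta); last first.
  by rewrite /eta; field; lra.
rewrite /potts_map expRD; set e := expR (2 * b * _).
have e0 : 0 < e by exact: expR_gt0.
have h1 : 1 - eta <= expR (- eta) by exact: expR_ge1Dx.
have h0 : 0 < expR (- eta) by exact: expR_gt0.
set D := 1 + (q%:R - 1) * e; set D' := 1 + _ * (e * _).
have qe0 : 0 < (q%:R - 1) * e by rewrite mulr_gt0 //; lra.
have D0 : 0 < D by rewrite /D; lra.
have D'1 : 1 <= D'.
  by rewrite /D' lerDl mulrA mulr_ge0 // ltW.
have D'D : (1 - eta) * D <= D'.
  have : (q%:R - 1) * e * (1 - eta) <= (q%:R - 1) * e * expR (- eta).
    by rewrite ler_pM2l.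
  rewrite /D /D'; lra.
apply: (@le_trans _ _ (D^-1 + eta)); last by rewrite lerD2l.
rewrite -(ler_pM2l (lt_le_trans ltr01 D'1)) divff ?lt0r_neq0 //; last first.
  exact: lt_le_trans D'1.
rewrite -(ler_pM2r D0) mul1r; clearbody D D'.
rewrite [leRHS](_ : _ = D' + eta * D * D'); last by field; exact: lt0r_neq0.
have : eta * D * 1 <= eta * D * D' by rewrite ler_wpM2l // mulr_ge0 // ltW.
lra.
Qed.

Definition Phi (theta : R) (s : conf) : R :=
  \sum_i \sum_k expR (theta * cnt s i k).

(** From [e^x (1 - x) <= 1] and [(1 + x + 2 x^2) (1 - x) = 1 + x^2 (1 - 2 x) >= 1]. *)
Lemma expR_le_quad (x : R) : `|x| <= 2^-1 -> expR x <= 1 + x + 2 * x ^+ 2.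
Proof.
rewrite ler_norml => /andP[x1 x2].
have e0 := expR_gt0 x.
have : expR x * (1 - x) <= 1.
  apply: (@le_trans _ _ (expR x * expR (- x))).
    by rewrite ler_pM2l // expR_ge1Dx.
  by rewrite -expRD subrr expR0.
have x10 : 0 < 1 - x by lra.
have : 1 <= (1 + x + 2 * x ^+ 2) * (1 - x).
  have : 0 <= x ^+ 2 * (1 - 2 * x) by rewrite mulr_ge0 ?sqr_ge0 //; lra.
  rewrite !expr2; lra.
by move=> /[swap] /le_trans h /h; rewrite ler_pM2r.
Qed.

Lemma glauber_op_sum {I : finType} (F : I -> conf -> R) s :
  glauber_op (fun t => \sum_i F i t) s = \sum_i glauber_op (F i) s.
Proof.
rewrite -glauber_opE; under eq_bigr => t _ do rewrite mulr_sumr.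
by rewrite exchange_big; apply: eq_bigr => i _; rewrite -glauber_opE.
Qed.

(** The chosen vertex lies in component [i] with probability [1 / m], and the count then moves by at
    most one. Its mean move is at most [pbar] minus the current proportion; the second-order term
    costs [2 theta^2]. *)
Lemma glauber_op_exp_cnt (theta pbar : R) s i k :
  0 <= theta -> theta <= 2^-1 -> (forall v, heat s v k <= pbar) ->
  glauber_op (fun t => expR (theta * cnt t i k)) s <=
  expR (theta * cnt s i k) *
    (1 + (theta * (pbar - cnt s i k / N%:R) + 2 * theta ^+ 2) / m%:R).
Proof.
move=> t0 t1 hp; set e := expR _; have e0 : 0 < e by exact: expR_gt0.
have NR : 0 < N%:R :> R := NR_gt0.
have MR : 0 < m%:R :> R := mR_gt0.
have step v a : expR (theta * cnt (upd s v a) i k) <= e * (1 + (v.1 == i)%:R *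
    (theta * ((a == k)%:R - (s v == k)%:R) + 2 * theta ^+ 2)).
  rewrite cnt_upd mulrDr expRD ler_pM2l //.
  case: (v.1 == i); last by rewrite !mul0r mulr0 expR0 addr0.
  rewrite !mul1r; set dd := (_ - _).
  have dd1 : `|dd| <= 1.
    by rewrite /dd; do 2 case: (_ == _);
      rewrite ?subrr ?normr0 ?subr0 ?sub0r ?normrN ?normr1.
  have q1 : `|theta * dd| <= theta.
    by rewrite normrM ger0_norm // ler_piMr.
  apply: (le_trans (expR_le_quad _ (le_trans q1 t1))).
  rewrite addrA lerD2l ler_pM2l // -[leLHS]ger0_norm ?sqr_ge0 //.
  by rewrite normrX lerXn2r ?nnegrE.
have -> : e *
    (1 + (theta * (pbar - cnt s i k / N%:R) + 2 * theta ^+ 2) / m%:R) =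
  n^-1 * \sum_v e * (1 + (v.1 == i)%:R *
    (theta * (pbar - (s v == k)%:R) + 2 * theta ^+ 2)).
  rewrite -mulr_sumr big_split /= sum_vertex_const sum_in_component.
  rewrite big_split /= -mulr_sumr sumrB -/(cnt s i k).
  rewrite !sum_ord_const.
  by field; rewrite !lt0r_neq0.
rewrite ler_pM2l ?invr_gt0 ?n_gt0 //; apply: ler_sum => v _.
apply: le_trans (ler_sum _ (fun a _ =>
  ler_wpM2l (heat_ge0 s v a) (step v a))) _.
have -> : \sum_(a < q) heat s v a * (e * (1 + (v.1 == i)%:R *
    (theta * ((a == k)%:R - (s v == k)%:R) + 2 * theta ^+ 2))) =
  e * (1 + (v.1 == i)%:R *
    (theta * (heat s v k - (s v == k)%:R) + 2 * theta ^+ 2)).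
  have hk : \sum_(a < q) heat s v a * (a == k)%:R = heat s v k.
    rewrite (bigD1 k) //= eqxx mulr1 big1 ?addr0 // => a /negPf ak.
    by rewrite ak mulr0.
  pose c := e * (1 + (v.1 == i)%:R *
    (theta * (- (s v == k)%:R) + 2 * theta ^+ 2)).
  rewrite (eq_bigr (fun a => heat s v a * c +
     e * (v.1 == i)%:R * theta * (heat s v a * (a == k)%:R))); last first.
    by move=> a _; rewrite /c; ring.
  by rewrite big_split /= -mulr_suml -mulr_sumr sum_heat hk /c; ring.
rewrite ler_pM2l // lerD2l ler_wpM2l // lerD2r ler_wpM2l // lerD2r.
exact: hp.
Qed.

Lemma Phi_op_le (theta pbar : R) s :
  0 <= theta -> theta <= 2^-1 -> (forall v k, heat s v k <= pbar) ->
  glauber_op (Phi theta) s <= \sum_i \sum_k expR (theta * cnt s i k) *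
    (1 + (theta * (pbar - cnt s i k / N%:R) + 2 * theta ^+ 2) / m%:R).
Proof.
move=> t0 t1 hp; rewrite /Phi glauber_op_sum; apply: ler_sum => i _.
rewrite glauber_op_sum; apply: ler_sum => k _.
by apply: glauber_op_exp_cnt => // v; exact: hp.
Qed.

Lemma max_cnt s : exists (M : R) i k,
  (forall j l, cnt s j l <= N%:R * M) /\ cnt s i k = N%:R * M.
Proof.
have NR : 0 < N%:R :> R := NR_gt0.
pose x0 := (Ordinal m_gt0, Ordinal (leq_trans (isT : (0 < 3)%N) q3)).
case: (@arg_maxP _ R _ x0 predT (fun x => cnt s x.1 x.2)) => // -[i k] _ ik.
exists (cnt s i k / N%:R), i, k.
rewrite mulrCA divff ?mulr1 ?lt0r_neq0 //; split=> // j l.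
exact: (ik (j, l)).
Qed.

Lemma Phi_ge_term theta s i k : expR (theta * cnt s i k) <= Phi theta s.
Proof.
rewrite /Phi (bigD1 i) //= (bigD1 k) //= -addrA lerDl addr_ge0 //.
  by rewrite sumr_ge0 // => *; exact: expR_ge0.
by rewrite sumr_ge0 // => *; rewrite sumr_ge0 // => *; exact: expR_ge0.
Qed.

Lemma Phi_le theta s (M : R) : 0 <= theta ->
  (forall i k, cnt s i k <= N%:R * M) ->
  Phi theta s <= m%:R * q%:R * expR (theta * (N%:R * M)).
Proof.
move=> t0 cM.
have -> : m%:R * q%:R * expR (theta * (N%:R * M)) =
    \sum_(i < m) \sum_(k < q) expR (theta * (N%:R * M)).
  by rewrite !sum_ord_const mulrA.
apply: ler_sum => i _; apply: ler_sum => k _.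
by rewrite ler_expR ler_wpM2l.
Qed.

Lemma Phi_drift (eps kappa : R) s :
  0 < kappa -> kappa <= 1 ->
  (forall x, q%:R^-1 + eps <= x -> x <= 1 ->
     potts_map (q := q) b x <= x - kappa) ->
  2 * b / N%:R <= kappa / 2 ->
  q%:R / N%:R <= kappa ^+ 2 / (64 * m%:R) ->
  glauber_op (Phi (kappa / 8)) s <=
    (1 - kappa ^+ 2 / (64 * m%:R)) * Phi (kappa / 8) s +
    3 * m%:R * q%:R * expR (kappa / 8 * (N%:R * (q%:R^-1 + eps))).
Proof.
move=> k0 k1 gap N1 N2.
(* This [theta] minimizes [2 theta^2 - theta kappa / 2]; the minimum is [- kappa^2 / 32], that is,
   [- 2 c m]. *)
set theta := kappa / 8; have t0 : 0 < theta by rewrite /theta; lra.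
have t1 : theta <= 2^-1 by rewrite /theta; lra.
have NR : 0 < N%:R :> R := NR_gt0.
have MR : 1 <= m%:R :> R := m1.
have MR0 : 0 < m%:R :> R := mR_gt0.
set c := kappa ^+ 2 / _; set E := expR _.
have c1 : 0 <= 1 - c.
  rewrite subr_ge0 /c ler_pdivrMr ?mulr_gt0 // mul1r expr2; nra.
have c0 : 0 <= c by rewrite /c divr_ge0 ?sqr_ge0 ?mulr_ge0 // ltW.
have Phi0 : 0 <= Phi theta s.
  by rewrite sumr_ge0 // => *; rewrite sumr_ge0 // => *; exact: expR_ge0.
have E0 : 0 < E by exact: expR_gt0.
have Q0 : 0 < q%:R :> R by rewrite ltr0n; exact: leq_trans q3.
have [M [i0 [k_0 [cM cMmax]]]] := max_cnt s.
(* Below the level there is no contraction to use: the trivial bound [heat <= 1] shows that a step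
   at most triples [Phi], which is itself at most [m q E] there. *)
case: (leP M (q%:R^-1 + eps)) => Mq.
  apply: (@le_trans _ _ (3 * Phi theta s)); last first.
    have : Phi theta s <= m%:R * q%:R * E.
      apply: Phi_le => [|i k]; first exact: ltW.
      by apply: le_trans (cM i k) _; rewrite ler_pM2l.
    have : 0 <= (1 - c) * Phi theta s by rewrite mulr_ge0.
    lra.
  apply: (le_trans (Phi_op_le theta 1 s (ltW t0) t1 (heat_le1 s))).
  rewrite /Phi mulr_sumr; apply: ler_sum => i _.
  rewrite mulr_sumr; apply: ler_sum => k _; rewrite [leRHS]mulrC.
  rewrite ler_pM2l ?expR_gt0 // -lerBrDl ler_pdivrMr //.
  have : 0 <= theta * (cnt s i k / N%:R).
    by rewrite mulr_ge0 ?divr_ge0 ?cnt_ge0 ?ltW.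
  have : theta ^+ 2 <= 2^-1 * 2^-1 by rewrite expr2 ler_pM // ltW.
  lra.
have M1 : M <= 1 by rewrite -(ler_pM2l NR) -cMmax mulr1 cnt_le.
(* Half of the gap [kappa] pays for the error [2 b / N]. *)
have hp v k : heat s v k <= M - kappa / 2.
  apply: le_trans (heat_le s v k M (fun j => cM j k)) _.
  have := gap M (ltW Mq) M1; lra.
apply: (le_trans (Phi_op_le theta _ s (ltW t0) t1 hp)).
set EM := expR (theta * (N%:R * M)).
have EMPhi : EM <= Phi theta s by rewrite /EM -cMmax Phi_ge_term.
(* [(M - x) e^(theta N x) <= e^(theta N M) / (theta N)], from [y <= e^y] *)
have term i k : expR (theta * cnt s i k) *
    (1 + (theta * (M - kappa / 2 - cnt s i k / N%:R) + 2 * theta ^+ 2)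
       / m%:R) <=
    (1 - 2 * c) * expR (theta * cnt s i k) + EM / (m%:R * N%:R).
  set x := expR _; have x0 : 0 < x by exact: expR_gt0.
  have : x * (theta * (N%:R * M - cnt s i k)) <= EM.
    have -> : EM = x * expR (theta * (N%:R * M - cnt s i k)).
      by rewrite /EM /x -expRD; congr expR; ring.
    by rewrite ler_pM2l //; apply: le_trans (expR_ge1Dx _); rewrite lerDr.
  set y := _ * (_ * _) => yE.
  have -> : x * (1 + (theta * (M - kappa / 2 - cnt s i k / N%:R) +
      2 * theta ^+ 2) / m%:R) =
    x * (1 + (2 * theta ^+ 2 - theta * (kappa / 2)) / m%:R) + y / (m%:R * N%:R).
    by rewrite /y; field; rewrite !lt0r_neq0.
  have -> : (2 * theta ^+ 2 - theta * (kappa / 2)) / m%:R = - (2 * c).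
    by rewrite /theta /c; field; rewrite lt0r_neq0.
  by rewrite mulrC lerD2l ler_pM2r ?invr_gt0 ?mulr_gt0.
apply: (@le_trans _ _ ((1 - 2 * c) * Phi theta s + q%:R / N%:R * EM)).
  have -> : (1 - 2 * c) * Phi theta s + q%:R / N%:R * EM =
    \sum_(i < m) \sum_(k < q) ((1 - 2 * c) * expR (theta * cnt s i k) +
      EM / (m%:R * N%:R)).
    under eq_bigr => i _ do rewrite big_split /= -mulr_sumr sum_ord_const.
    rewrite big_split /= -mulr_sumr sum_ord_const.
    by congr (_ + _); field; rewrite !lt0r_neq0.
  by apply: ler_sum => i _; apply: ler_sum => k _; exact: term.
(* One of the two gained [c * Phi] absorbs the error from the non-maximal counts, using that [EM] is
   itself a term of [Phi]. *)
have : q%:R / N%:R * EM <= c * Phi theta s.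
  by rewrite ler_pM // ?divr_ge0 ?ltW ?expR_gt0.
have : 0 <= 3 * m%:R * q%:R * E by rewrite !mulr_ge0 // ltW.
lra.
Qed.

(** The deviations sum to zero, so an upper bound [U] on each forces each to be at least
    [- (q - 1) U]. *)
Lemma centered_bound (F : 'I_q -> R) (c U : R) : 0 <= U ->
  \sum_k F k = q%:R * c -> (forall k, F k - c <= U) ->
  forall k, `|F k - c| <= q%:R * U.
Proof.
move=> U0 Fc FU k.
have Q3 : 3 <= q%:R :> R by rewrite ler_nat.
have UqU : U <= q%:R * U by rewrite ler_peMl //; lra.
rewrite ler_norml (le_trans (FU k) UqU) andbT.
have S0 : \sum_l (F l - c) = 0.
  by rewrite sumrB Fc sum_ord_const subrr.
move: S0; rewrite (bigD1 k) //=.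
have : \sum_(l < q | l != k) (F l - c) <= \sum_(l < q | l != k) U.
  by apply: ler_sum => l _; exact: FU.
have : \sum_(l < q) U = q%:R * U by rewrite sum_ord_const.
rewrite (bigD1 k) //=; lra.
Qed.

(** A disagreement at [w] changes the colour indicators by at most 2 in l1, and the weights of [w]
    sum to [N J]; with the prefactor [2 beta / N] this makes [4 b]. *)
Lemma sum_field_diff (x : conf * conf) :
  \sum_v \sum_k `|field x.1 v k - field x.2 v k| <= 4 * b * hamming x.
Proof.
have NR : 0 < N%:R :> R := NR_gt0.
have ind (a c : 'I_q) :
    \sum_k `|(a == k)%:R - (c == k)%:R| <= 2 * (a != c)%:R :> R.
  case: (eqVneq a c) => [->|_].
    by rewrite mulr0 big1 // => k _; rewrite subrr normr0.
  apply: (@le_trans _ _ (\sum_(k < q) ((a == k)%:R + (c == k)%:R))).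
    apply: ler_sum => k _; apply: le_trans (ler_normB _ _) _.
    by rewrite !ger0_norm.
  by rewrite big_split /= !sum_indicator mulr1.
have -> : 4 * b * hamming x =
   \sum_v 2 * beta / N%:R * \sum_w acoup w v * (2 * (x.1 w != x.2 w)%:R).
  rewrite -mulr_sumr exchange_big /=.
  rewrite (eq_bigr (fun w => N%:R * J * (2 * (x.1 w != x.2 w)%:R))); last first.
    by move=> w _; rewrite -mulr_suml sum_interaction.
  rewrite -mulr_sumr -mulr_sumr -/(hamming x).
  by field; rewrite lt0r_neq0.
apply: ler_sum => v _.
apply: (@le_trans _ _ (\sum_k 2 * beta / N%:R * \sum_w
    acoup w v * `|(x.1 w == k)%:R - (x.2 w == k)%:R|)).
  apply: ler_sum => k _; rewrite /field -mulrBr normrM ger0_norm; last first.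
    by rewrite divr_ge0 ?mulr_ge0 // ltW.
  rewrite ler_pM2l ?divr_gt0 ?mulr_gt0 // -sumrB.
  apply: le_trans (ler_norm_sum _ _ _) _.
  rewrite [leRHS](bigD1 v) //= -[leLHS]add0r lerD //.
    by rewrite mulr_ge0 // coupling_const_ge0.
  apply: ler_sum => w _.
  rewrite -mulrBr normrM ger0_norm ?coupling_const_ge0 //.
  by rewrite !interactionE coupling_constC.
rewrite -mulr_sumr ler_pM2l ?divr_gt0 ?mulr_gt0 // exchange_big /=.
apply: ler_sum => w _; rewrite -mulr_sumr ler_wpM2l ?coupling_const_ge0 //.
Qed.

(** The two fields at [v] have the same mean [c v], which depends on [v] alone, and stay within [r]
    of it, so [softmax_lip] applies. The [1 / 2] in [excessE] turns [4 b] into [2 b]. *)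
Lemma sum_excess_le (x : conf * conf) (eps r : R) :
  0 <= eps ->
  (forall i k, cnt x.1 i k <= N%:R * (q%:R^-1 + 2 * eps)) ->
  (forall i k, cnt x.2 i k <= N%:R * (q%:R^-1 + 2 * eps)) ->
  q%:R * (4 * b * eps + 2 * b / N%:R) <= r ->
  \sum_v excess (heat x.1 v) (heat x.2 v) <=
    (2 * expR r - 1) * (2 * b) / q%:R * hamming x.
Proof.
move=> eps0 c1 c2 hr.
have Q3 : 3 <= q%:R :> R by rewrite ler_nat.
have Q0 : 0 < q%:R :> R by lra.
have NR : 0 < N%:R :> R := NR_gt0.
have b0 : 0 < b := b_gt0.
set U := 4 * b * eps + _ in hr.
have U0 : 0 <= U by rewrite addr_ge0 ?mulr_ge0 ?invr_ge0 // ltW.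
have r0 : 0 <= r by apply: le_trans hr; rewrite mulr_ge0 // ltW.
have er : 1 <= expR r by rewrite -[leLHS]expR0 ler_expR.
pose c (v : vert) : R :=
  (2 * b - 2 * beta / N%:R * coupling_const v.1 v.1) / q%:R.
have cE s v : \sum_k field s v k = q%:R * c v.
  by rewrite sum_field /c [RHS]mulrC divfK // lt0r_neq0.
have cr s v k : (forall i k, cnt s i k <= N%:R * (q%:R^-1 + 2 * eps)) ->
    `|field s v k - c v| <= r.
  move=> cs; apply: le_trans hr; apply: centered_bound => // l.
  have := field_le s v l _ (fun j => cs j l).
  have /andP[] := self_field_bound v.1.
  rewrite /c /U; set d := _ * coupling_const _ _ => d0 dN.
  have : d / q%:R <= 2 * b / N%:R.
    by apply: le_trans dN; rewrite ler_pdivrMr ?ler_peMr //; lra.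
  lra.
apply: (@le_trans _ _ (\sum_v 2^-1 * ((2 * expR r - 1) / q%:R *
   \sum_k `|field x.1 v k - field x.2 v k|))).
  apply: ler_sum => v _; rewrite excessE // ler_pM2l //.
  by apply: (softmax_lip q3 _ _ (c v)) => // k; exact: cr.
rewrite -!mulr_sumr.
have h := sum_field_diff x.
have : (2 * expR r - 1) / q%:R * \sum_v \sum_k `|field x.1 v k - field x.2 v k|
    <= (2 * expR r - 1) / q%:R * (4 * b * hamming x).
  by rewrite ler_wpM2l // divr_ge0 ?ltW //; lra.
lra.
Qed.

(** * The two phases *)

Section Assembly.
Variables (eps kappa r : R).
Hypotheses (eps_gt0 : 0 < eps) (kappa_gt0 : 0 < kappa) (kappa_le1 : kappa <= 1).
Hypothesis gap : forall x, q%:R^-1 + eps <= x -> x <= 1 ->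
  potts_map (q := q) b x <= x - kappa.
Hypothesis N_field : 2 * b / N%:R <= kappa / 2.
Hypothesis N_drift : q%:R / N%:R <= kappa ^+ 2 / (64 * m%:R).
Hypothesis r_field : q%:R * (4 * b * eps + 2 * b / N%:R) <= r.

Local Notation theta := (kappa / 8).
Local Notation c1 := (kappa ^+ 2 / (64 * m%:R)).
Local Notation rho := ((2 * expR r - 1) * (2 * b) / q%:R).
Local Notation c2 := ((1 - rho) / m%:R).
Local Notation mq := (m%:R * q%:R : R).

(** [Phi] rescaled so as to dominate the indicator that some proportion exceeds [1/q + 2 eps]. *)
Definition psi (s : conf) : R :=
  expR (- (theta * (N%:R * (q%:R^-1 + 2 * eps)))) * Phi theta s.

Lemma psi_ge0 s : 0 <= psi s.
Proof.
rewrite mulr_ge0 ?expR_ge0 // sumr_ge0 // => *.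
by rewrite sumr_ge0 // => *; exact: expR_ge0.
Qed.

Lemma psi_ge1 s i k : N%:R * (q%:R^-1 + 2 * eps) < cnt s i k -> 1 <= psi s.
Proof.
move=> h; rewrite /psi expRN mulrC ler_pdivlMr ?expR_gt0 // mul1r.
apply: le_trans (Phi_ge_term _ s i k).
by rewrite ler_expR ler_pM2l ?divr_gt0 // ltW.
Qed.

Lemma psi_le s : psi s <= mq * expR (theta * N%:R).
Proof.
have t0 : 0 < theta by rewrite divr_gt0.
rewrite -[leRHS]mul1r ler_pM ?expR_ge0 //.
- by rewrite sumr_ge0 // => *; rewrite sumr_ge0 // => *; exact: expR_ge0.
- rewrite -[leRHS]expR0 ler_expR oppr_le0 mulr_ge0 ?(ltW t0) //.
  by rewrite mulr_ge0 // addr_ge0 ?invr_ge0 ?mulr_ge0 // ltW.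
- have := Phi_le theta s 1 (ltW t0); rewrite mulr1; apply => i k.
  exact: cnt_le.
Qed.

Let D := 3 * mq * expR (- (theta * eps * N%:R)).

(** [Phi] drifts down to level [1/q + eps] while [psi] is scaled at [1/q + 2 eps]; the margin [eps]
    makes the additive term [D] exponentially small in [N]. *)
Lemma psi_drift s : glauber_op psi s <= (1 - c1) * psi s + D.
Proof.
have [_ lin cst] := glauber_op_averaging.
set e := expR (- (theta * (N%:R * (q%:R^-1 + 2 * eps)))).
have e0 : 0 < e by exact: expR_gt0.
have -> : glauber_op psi s = e * glauber_op (Phi theta) s.
  have := lin e (Phi theta) (fun=> 0) s; rewrite cst addr0 => <-.
  by congr (glauber_op _ s); apply/funext => t; rewrite /psi addr0.
have -> : D = e * (3 * m%:R * q%:R * expR (theta * (N%:R * (q%:R^-1 + eps)))).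
  rewrite /D [RHS]mulrCA -expRD !mulrA; congr (_ * expR _); ring.
rewrite /psi -/e [(1 - _) * _]mulrCA -mulrDr ler_pM2l //.
exact: Phi_drift.
Qed.

Let c1_gt0 : 0 < c1.
Proof. by rewrite divr_gt0 ?exprn_gt0 // mulr_gt0. Qed.

Let c1_le1 : c1 <= 1.
Proof.
have MR : 1 <= m%:R :> R by rewrite ler1n.
have k0 := kappa_gt0; have k1 := kappa_le1.
rewrite ler_pdivrMr ?mulr_gt0 // mul1r expr2; nra.
Qed.

(** The initial value is at most [mq * expR (theta * N)], and the hypothesis on [j] is exactly what
    lets the contraction cancel this exponential. *)
Lemma iter_psi_le s (j : nat) : theta * N%:R <= c1 * j%:R ->
  iter j glauber_op psi s <= mq + 3 * mq / c1.
Proof.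
move=> hj.
have t0 : 0 < theta by rewrite divr_gt0.
have D0 : 0 <= D by rewrite mulr_ge0 ?expR_ge0 // !mulr_ge0.
apply: le_trans (averaging_drift _ _ _ _ j s glauber_op_averaging
  c1_gt0 c1_le1 D0 psi_drift) _.
have c10 := c1_gt0.
apply: lerD; last first.
  rewrite ler_pM2r ?invr_gt0 // -[leRHS]mulr1 ler_wpM2l ?mulr_ge0 //.
  by rewrite -[leRHS]expR0 ler_expR oppr_le0 !mulr_ge0 // ltW.
have p1 : (1 - c1) ^+ j <= expR (- (c1 * j%:R)).
  exact: one_subX_le_expR.
have p0 : 0 <= (1 - c1) ^+ j by rewrite exprn_ge0 // subr_ge0.
apply: le_trans (ler_pM p0 (psi_ge0 s) p1 (psi_le s)) _.
rewrite mulrCA -[leRHS]mulr1 ler_wpM2l ?mulr_ge0 // -expRD -[leRHS]expR0.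
by rewrite ler_expR addrC subr_le0.
Qed.

Hypotheses (rho_ge0 : 0 <= rho) (rho_lt1 : rho < 1).

Let c2n_gt0 : 0 < c2 / N%:R.
Proof. by rewrite !divr_gt0 // subr_gt0. Qed.

(** If both configurations are good, [sum_excess_le] gives the contraction. Otherwise the step adds
    at most 1 to the distance, and some [psi >= 1] pays for it. *)
Lemma hamming_drift x : coupled_op hamming x <=
  (1 - c2 / N%:R) * hamming x + (psi x.1 + psi x.2).
Proof.
have n0 := n_gt0; have H0 := hamming_ge0 x.
have p1 := psi_ge0 x.1; have p2 := psi_ge0 x.2.
apply: le_trans (coupled_op_hamming x) _.
have -> : (1 - c2 / N%:R) * hamming x =
    (1 - n^-1) * hamming x + n^-1 * (rho * hamming x).
  by field; rewrite !lt0r_neq0 // ltr0n; exact: leq_trans q3.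
rewrite -addrA lerD2l.
have rH : 0 <= n^-1 * (rho * hamming x).
  by rewrite mulr_ge0 ?invr_ge0 ?(ltW n0) // mulr_ge0.
pose good (s : conf) :=
  [forall i, forall k, cnt s i k <= N%:R * (q%:R^-1 + 2 * eps)].
have goodP s : good s ->
    forall i k, cnt s i k <= N%:R * (q%:R^-1 + 2 * eps).
  by move=> /forallP h i k; exact: (forallP (h i)).
have badP s : ~~ good s -> 1 <= psi s.
  rewrite negb_forall => /existsP[i]; rewrite negb_forall => /existsP[k].
  by rewrite -ltNge; exact: psi_ge1.
have le1 : n^-1 * \sum_v excess (heat x.1 v) (heat x.2 v) <= 1.
  rewrite mulrC ler_pdivrMr // mul1r -[leRHS]mulr1.
  rewrite -sum_vertex_const; apply: ler_sum => v _.
  by apply: excess_le1; [exact: sum_heat|exact: heat_ge0|exact: heat_ge0].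
have [g1|/badP] := boolP (good x.1); last by lra.
have [g2|/badP] := boolP (good x.2); last by lra.
have := sum_excess_le x eps r (ltW eps_gt0) (goodP _ g1) (goodP _ g2) r_field.
rewrite -(@ler_pM2l _ n^-1) ?invr_gt0 //; lra.
Qed.

Hypothesis N_rate : c2 / N%:R <= c1 / 2.

(** A Lyapunov function [W] joins the distance with multiples of both [psi]. The first [j1] steps
    bring the expectation of [psi] down to a constant; during the next [j2] steps [W] contracts at
    rate [c2 / N]. *)
Lemma iter_hamming_le j1 j2 x : theta * N%:R <= c1 * j1%:R ->
  iter (j1 + j2) coupled_op hamming x <=
    expR (- (c2 / N%:R * j2%:R)) *
      (2 * (2 / c1) * (mq + 3 * mq / c1) + n) +
    2 * (2 / c1) * D / (c2 / N%:R).
Proof.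
move=> hj1.
have c10 := c1_gt0; have c2n0 := c2n_gt0.
have c2n1 : c2 / N%:R <= 1.
  apply: le_trans N_rate _; have := c1_le1; lra.
(* With [A * c1 = 2] the decay of [A * psi] yields [2 psi]: one [psi] cancels the loss in
   [hamming_drift], the other covers [A * c * psi], as [A * c <= 1] by [N_rate]. *)
set A := 2 / c1; set c := c2 / N%:R; have A0 : 0 < A by rewrite divr_gt0.
have Ac1 : A * c1 = 2 by rewrite /A divfK // lt0r_neq0.
have D0 : 0 <= D by rewrite mulr_ge0 ?expR_ge0 // !mulr_ge0.
have AD0 : 0 <= 2 * A * D.
  by apply: mulr_ge0 => //; apply: mulr_ge0 => //; exact: ltW.
pose f1 (x : conf * conf) := psi x.1; pose f2 (x : conf * conf) := psi x.2.
pose W x := A * f1 x + (A * f2 x + hamming x).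
have split j y : iter j coupled_op W y =
    A * iter j glauber_op psi y.1 +
      (A * iter j glauber_op psi y.2 + iter j coupled_op hamming y).
  have [_ lin _] := averaging_iter _ j coupled_op_averaging.
  rewrite /W (lin A f1 (fun x => A * f2 x + hamming x)) lin.
  by rewrite /f1 /f2 iter_coupled_op_fst iter_coupled_op_snd.
have Wdrift y : coupled_op W y <= (1 - c) * W y + 2 * A * D.
  have := split 1 y => /= ->.
  have d1 := psi_drift y.1; have d2 := psi_drift y.2.
  have dH := hamming_drift y; rewrite -/c in dH.
  have : A * glauber_op psi y.1 <= A * ((1 - c1) * psi y.1 + D).
    by rewrite ler_pM2l.
  have : A * glauber_op psi y.2 <= A * ((1 - c1) * psi y.2 + D).
    by rewrite ler_pM2l.
  have Ac : A * c <= 1.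
    by apply: le_trans (ler_wpM2l (ltW A0) N_rate) _; rewrite mulrA Ac1; lra.
  have : 0 <= (1 - A * c) * (psi y.1 + psi y.2).
    by rewrite mulr_ge0 ?subr_ge0 // addr_ge0 // psi_ge0.
  rewrite /W /f1 /f2 !mulrDr ![A * (_ * psi _)]mulrA mulrBr mulr1 Ac1.
  clearbody A c D; lra.
have HW y : hamming y <= W y.
  by rewrite /W addrA lerDr addr_ge0 // mulr_ge0 ?psi_ge0 // ltW.
have [mono _ _] := averaging_iter _ (j1 + j2) coupled_op_averaging.
apply: le_trans (mono _ _ HW x) _.
(* The outer iterate is the earlier phase in time: the last [j2] steps are bounded from an arbitrary
   state, then averaged over the first [j1]. *)
rewrite iterD.
have [mono1 lin1 cst1] := averaging_iter _ j1 coupled_op_averaging.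
apply: le_trans (mono1 _ (fun y => (1 - c) ^+ j2 * W y + 2 * A * D / c) _ x) _.
  move=> y; exact: (averaging_drift _ _ _ _ j2 y coupled_op_averaging
    c2n0 c2n1 AD0 Wdrift).
rewrite lin1 cst1 lerD2r.
have c1c : 0 <= 1 - c by rewrite subr_ge0.
have W0 y : 0 <= W y by apply: le_trans (HW y); exact: hamming_ge0.
apply: ler_pM.
- by rewrite exprn_ge0.
- by rewrite -[leLHS](cst1 0 x); exact: mono1.
- exact: one_subX_le_expR.
rewrite split.
have p1 := ler_wpM2l (ltW A0) (iter_psi_le x.1 j1 hj1).
have p2 := ler_wpM2l (ltW A0) (iter_psi_le x.2 j1 hj1).
have pH : iter j1 coupled_op hamming x <= n.
  by rewrite -[leRHS](cst1 n x); apply: mono1; exact: hamming_le.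
apply: le_trans (lerD p1 (lerD p2 pH)) _.
by rewrite addrA lerD2r -[leRHS]mulrA [leRHS]mulr_natl mulr2n.
Qed.

End Assembly.
End Dynamics.

(** * Numerical estimates and choice of constants *)

Lemma tmix_le {R : realType} (q m N : nat) (lam J beta : R) (j : nat) :
  (0 < j)%N ->
  (forall s : config q m N,
     Defs.total_variation (glauber_law lam J beta s j) (gibbs lam J beta)
       <= 4^-1) ->
  (tmix q m N lam J beta <= (j%:R)%:E)%E.
Proof.
move=> j0 H; apply: ereal_inf_lbound; exists j => //; split=> //.
by apply: bigmax_le => [|s _]; [rewrite invr_ge0 | exact: H].
Qed.

(** Each summand is at most [1/8]: the first by [expR (- (c2 * L)) <= x^-2], the second by
    [expR (- (a * x)) <= 4 / (a x)^2]. *)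
Lemma two_phase_bound {R : realType} (c2 a K1 K2 M L x : R) :
  0 < c2 -> 0 < a -> 0 <= K1 -> 0 <= K2 -> 0 <= M -> 1 <= x ->
  8 * (K1 + M) <= x -> 32 * K2 / a ^+ 2 <= x -> 2 * ln x <= c2 * L ->
  expR (- (c2 * L)) * (K1 + M * x) + K2 * expR (- (a * x)) * x <= 4^-1.
Proof.
move=> c20 a0 K10 K20 M0 x1 hx1 hx2 hL.
have x0 : 0 < x by lra.
have eL : expR (- (c2 * L)) <= (x ^+ 2)^-1.
  rewrite -[X in _ <= (X ^+ 2)^-1]lnK ?posrE // -expRM_natl -expRN ler_expR.
  by rewrite lerN2.
have ea : expR (- (a * x)) <= 4 / (a ^+ 2 * x ^+ 2).
  have y0 : 0 < a ^+ 2 * x ^+ 2 / 4.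
    by rewrite divr_gt0 // mulr_gt0 // exprn_gt0.
  rewrite expRN -[leRHS]invf_div lef_pV2 ?posrE ?expR_gt0 //.
  have -> : a ^+ 2 * x ^+ 2 / 4 = (a * x / 2) ^+ 2 by field.
  have -> : a * x = 2%:R * (a * x / 2) by field.
  rewrite expRM_natl lerXn2r ?nnegrE ?expR_ge0 //.
    by rewrite divr_ge0 ?mulr_ge0 // ltW.
  have -> : 2 * (a * x / 2) / 2 = a * x / 2 by field.
  by apply: le_trans (expR_ge1Dx _); rewrite lerDr.
have t1 : expR (- (c2 * L)) * (K1 + M * x) <= 8^-1.
  apply: (@le_trans _ _ ((x ^+ 2)^-1 * ((K1 + M) * x))).
    apply: ler_pM => //; rewrite ?expR_ge0 ?addr_ge0 ?mulr_ge0 ?(ltW x0) //.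
    by rewrite mulrDl lerD2r ler_peMr.
  rewrite (_ : (x ^+ 2)^-1 * _ = (K1 + M) / x); last by field; lra.
  by rewrite ler_pdivrMr //; lra.
have t2 : K2 * expR (- (a * x)) * x <= 8^-1.
  apply: (@le_trans _ _ (K2 * (4 / (a ^+ 2 * x ^+ 2)) * x)).
    by rewrite ler_pM2r // ler_wpM2l.
  rewrite (_ : K2 * _ * x = 8^-1 * (32 * K2 / a ^+ 2 / x)); last first.
    by field; lra.
  by rewrite ler_piMr // ler_pdivrMr // mul1r.
lra.
Qed.

Lemma softmax_slope_radius {R : realType} (q : nat) (b : R) : (3 <= q)%N ->
  0 < b -> 2 * b < q%:R ->
  exists r, [/\ 0 < r, 0 <= (2 * expR r - 1) * (2 * b) / q%:R &
    (2 * expR r - 1) * (2 * b) / q%:R < 1].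
Proof.
move=> q3 b0 bq.
have Q3 : 3 <= q%:R :> R by rewrite ler_nat.
have qb : 1 < q%:R / (2 * b) by rewrite ltr_pdivlMr ?mul1r // mulr_gt0.
(* With [expR r = y] the contraction factor becomes the midpoint of [2 b / q] and 1. *)
set y := (q%:R / (2 * b) + 3) / 4.
have y1 : 1 < y by rewrite /y; lra.
exists (ln y); rewrite lnK ?posrE; last by lra.
have e : (2 * y - 1) * (2 * b) / q%:R = 2^-1 * (1 + 2 * b / q%:R).
  by rewrite /y; field; lra.
have d0 : 0 < 2 * b / q%:R by rewrite divr_gt0 ?mulr_gt0 //; lra.
have d1 : 2 * b / q%:R < 1 by rewrite ltr_pdivrMr ?mul1r //; lra.
rewrite e; split; [exact: ln_gt0|lra|lra].
Qed.

Theorem theorem1 (R : realType) (q m : nat) (lam J beta : R) :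
  (3 <= q)%N -> (1 <= m)%N -> 0 < lam -> lam < 1 -> 0 < J ->
  0 < beta -> beta < beta_s R q / J ->
  exists C : R, 0 < C /\ exists N0 : nat, forall N : nat, (N0 <= N)%N ->
    (tmix q m N lam J beta <= (C * N%:R * ln N%:R)%:E)%E.
Proof.
move=> q3 m1 lam0 lam1 J0 beta0 hbeta.
have Q3 : 3 <= q%:R :> R by rewrite ler_nat.
have M1 : 1 <= m%:R :> R by rewrite ler1n.
have b0 : 0 < beta * J by rewrite mulr_gt0.
have bs : beta * J < beta_s R q by rewrite -ltr_pdivlMr.
have [r [r0 rho0 rho1]] :=
  softmax_slope_radius _ _ q3 b0 (beta_s_slope q3 _ bs).
set rho := _ / q%:R in rho0 rho1.
(* Then [q * 4 b * eps = r / 2], leaving [r / 2] for the [1 / N] correction. *)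
pose eps := r / (8 * q%:R * (beta * J)).
have eps0 : 0 < eps by rewrite divr_gt0 // !mulr_gt0 //; lra.
have [k' k'0 gap'] := potts_map_gap q3 _ _ b0 bs eps0.
pose kappa := Num.min k' 1.
have k0 : 0 < kappa by rewrite lt_min k'0 ltr01.
have k1 : kappa <= 1 by rewrite ge_min lexx orbT.
have gap x : q%:R^-1 + eps <= x -> x <= 1 ->
    potts_map (q := q) (beta * J) x <= x - kappa.
  move=> /gap' /[apply] /le_trans; apply.
  by rewrite lerD2l lerN2 ge_min lexx.
pose theta := kappa / 8; pose c1 := kappa ^+ 2 / (64 * m%:R).
pose c2 := (1 - rho) / m%:R; pose mq : R := m%:R * q%:R.
have theta0 : 0 < theta by rewrite divr_gt0.
have c10 : 0 < c1 by rewrite divr_gt0 ?exprn_gt0 // mulr_gt0 //; lra.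
have c20 : 0 < c2 by rewrite divr_gt0 ?subr_gt0 //; lra.
have mq0 : 0 < mq by rewrite mulr_gt0; lra.
pose K1 := 2 * (2 / c1) * (mq + 3 * mq / c1).
pose K2 := 2 * (2 / c1) * (3 * mq) / c2.
have A0 : 0 < 2 * (2 / c1) by apply: mulr_gt0 => //; exact: divr_gt0.
have B0 : 0 < 3 * mq by apply: mulr_gt0.
have K10 : 0 < K1.
  by apply: mulr_gt0 => //; apply: addr_gt0 => //; exact: divr_gt0.
have K20 : 0 < K2 by apply: divr_gt0 => //; exact: mulr_gt0.
pose a := theta * eps; have a0 : 0 < a by rewrite mulr_gt0.
pose T := Num.bound (theta / c1).
have hT : theta < c1 * T%:R.
  by rewrite mulrC -ltr_pdivrMr // archi_boundP // divr_ge0 // ltW.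
(* Each positive summand is one lower bound on [N] required below; [expR 1] ensures [1 <= ln N], so
   that constants are absorbed into [C * ln N]. *)
pose X := 1 + expR 1 + 4 * (beta * J) / kappa + q%:R / c1 +
  4 * (beta * J) * q%:R / r + 2 * c2 / c1 + 8 * (K1 + m%:R) +
  32 * K2 / a ^+ 2.
have x1 : 0 < 4 * (beta * J) / kappa by rewrite divr_gt0 // mulr_gt0.
have x2 : 0 < q%:R / c1 by rewrite divr_gt0 //; lra.
have x3 : 0 < 4 * (beta * J) * q%:R / r.
  by rewrite divr_gt0 // !mulr_gt0 //; lra.
have x4 : 0 < 2 * c2 / c1 by rewrite divr_gt0 // mulr_gt0.
have x5 : 0 < 8 * (K1 + m%:R) by rewrite mulr_gt0 // addr_gt0 //; lra.
have x6 : 0 < 32 * K2 / a ^+ 2 by rewrite divr_gt0 ?exprn_gt0 // mulr_gt0.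
have x7 := expR_gt0 (1 : R).
have X0 : 0 <= X by rewrite /X; lra.
exists (T%:R + 1 + 2 / c2); split.
  by rewrite !ltr_wpDl // divr_gt0.
exists (Num.bound X) => N hN.
have XN : X <= N%:R.
  by apply: le_trans (ltW (archi_boundP X0)) _; rewrite ler_nat.
have N1 : 1 <= N%:R :> R by rewrite /X in XN; lra.
have Ne : expR 1 <= N%:R :> R by rewrite /X in XN; lra.
have N0 : 0 < N%:R :> R by lra.
have N0' : (0 < N)%N by rewrite -(ltr0n R).
have lnN : 1 <= ln N%:R :> R.
  by rewrite -(@ler_expR R) lnK ?posrE.
(* The phases last [N * T] and [N * L] steps. Rounding [2 ln N / c2] up brings the contraction
   factor of the second phase below [N^-2]. *)
pose L := (Num.truncn (2 * ln N%:R / c2)).+1.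
have y0 : 0 <= 2 * ln N%:R / c2 by rewrite divr_ge0 ?(ltW c20) //; lra.
have hL : 2 * ln N%:R <= c2 * L%:R.
  by rewrite [leRHS]mulrC -ler_pdivrMr // ltW // truncnS_gt.
have hL' : L%:R <= 2 * ln N%:R / c2 + 1.
  by rewrite /L -natr1 lerD2r truncn_le.
apply: (@le_trans _ _ ((N * T + N * L)%:R)%:E); last first.
  rewrite lee_fin natrD !natrM -mulrDr [leRHS]mulrAC [leRHS]mulrC ler_pM2l //.
  apply: le_trans (lerD (lexx _) hL') _.
  have : (T%:R + 1) * 1 <= (T%:R + 1) * ln N%:R :> R.
    by rewrite ler_wpM2l // addr_ge0.
  lra.
apply: tmix_le => [|s]; first by rewrite -mulnDr muln_gt0 N0' addnS.
apply: (total_variation_gibbs q3 m1 N0') => x.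
have h1 : 2 * (beta * J) / N%:R <= kappa / 2.
  rewrite ler_pdivrMr // [leRHS]mulrC -ler_pdivrMr ?divr_gt0 // invf_div.
  rewrite /X in XN; lra.
have h2 : q%:R / N%:R <= c1.
  rewrite ler_pdivrMr // [leRHS]mulrC -ler_pdivrMr //; rewrite /X in XN; lra.
have h3 : q%:R * (4 * (beta * J) * eps + 2 * (beta * J) / N%:R) <= r.
  have -> : q%:R * (4 * (beta * J) * eps + 2 * (beta * J) / N%:R) =
      r / 2 + r / 2 * (4 * (beta * J) * q%:R / r / N%:R).
    rewrite /eps; field; rewrite !lt0r_neq0 //; lra.
  have : 4 * (beta * J) * q%:R / r / N%:R <= 1.
    rewrite ler_pdivrMr // mul1r; rewrite /X in XN; lra.
  by rewrite -(@ler_pM2l _ (r / 2)) ?divr_gt0 //; lra.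
have h4 : c2 / N%:R <= c1 / 2.
  have : 2 * c2 / c1 <= N%:R by rewrite /X in XN; lra.
  rewrite ler_pdivrMr // => h.
  by rewrite ler_pdivrMr // mulrAC ler_pdivlMr // mulrC [leRHS]mulrC.
have hj : theta * N%:R <= c1 * (N * T)%:R.
  by rewrite natrM mulrCA [leLHS]mulrC ler_pM2l // ltW.
apply: le_trans (iter_hamming_le q3 m1 N0' lam0 J0 beta0 eps kappa r eps0 k0 k1
  gap h1 h2 h3 rho0 rho1 h4 (N * T) (N * L) x hj) _.
rewrite -/rho -/theta -/c1 -/c2 -/mq.
have -> : c2 / N%:R * (N * L)%:R = c2 * L%:R.
  by rewrite natrM; field; lra.
have -> : 2 * (2 / c1) * (3 * mq * expR (- (theta * eps * N%:R))) /
      (c2 / N%:R) =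
    K2 * expR (- (a * N%:R)) * N%:R.
  by rewrite /K2 -/a; field; rewrite !lt0r_neq0.
have g1 : 8 * (K1 + m%:R) <= N%:R by rewrite /X in XN; lra.
have g2 : 32 * K2 / a ^+ 2 <= N%:R by rewrite /X in XN; lra.
apply: two_phase_bound => //; exact: ltW.
Qed.
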